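(* Let $(K\prec L,v)$ be two models of $ACVF$, with $K$ an elementary substructure of $L$. The following are equivalent: \begin{enumerate} \item $T_n(K,L)$ holds for all $n\geq 1$; \item $(K\subseteq L,v)$ is a separated extension and $T_1(vK,vL)$ holds. \end{enumerate}
   Context: $ACVF$ is the theory of algebraically closed non-trivially valued fields, for instance in the language of rings together with a binary predicate $x|y$ interpreted as $v(x)\leq v(y)$. For a valued field $(K,v)$, $vK$ denotes its value group, regarded as a structure in the language of ordered groups. Definable types: for a structure $M$ in a first-order language and a type $p(x)$ over $M$ ($x$ a finite tuple), $p$ is definable if for every formula $\phi(x,y)$ without parameters there is a formula $\delta_\phi(y)$ with parameters in $M$ such that for all $a\in M^{|y|}$, $\phi(x,a)\in p$ if and only if $M\models\delta_\phi(a)$. For structures $M\prec N$ and $n\geq 1$, $T_n(M,N)$ means: for every $a\in N^n$, the type $tp(a/M)$ is definable. (For $T_n(K,L)$ this is in the valued field language; for $T_1(vK,vL)$ it is in the language of ordered groups.) Let $(K\subseteq L,v)$ be an extension of valued fields. A sequence $y_1,\ldots,y_n\in L$ is separated if for all $k_1,\ldots,k_n\in K$, $v\left(\sum_{i=1}^n k_iy_i\right)=\min\{v(k_iy_i):1\leq i\leq n\}$. The extension $(K\subseteq L,v)$ is separated if every finitely generated $K$-vector subspace of $L$ has a separated basis, i.e. for all $x_1,\ldots,x_n\in L$ there is a basis $y_1,\ldots,y_m\in L$ of $\sum x_iK$ over $K$ which is a separated sequence. *)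

(* Defs.v *)
From HB Require Import structures.
From mathcomp Require Import all_boot all_order all_algebra.

Set Implicit Arguments.
Unset Strict Implicit.
Unset Printing Implicit Defensive.

Import Order.TTheory GRing.Theory Num.Theory.
Local Open Scope ring_scope.

(** * First-order logic *)

Record language := Language {
  fsym : Type;
  farity : fsym -> nat;
  rsym : Type;
  rarity : rsym -> nat }.

Record structure (S : language) := Structure {
  carrier :> Type;
  fun_interp : forall f : fsym S, (farity f).-tuple carrier -> carrier;
  rel_interp : forall r : rsym S, (rarity r).-tuple carrier -> Prop }.

(** [term S n] and [formula S n] have their free variables among
    [x_0, ..., x_{n-1}].  In [All phi] the bound variable is the variable [0]
    of [phi], the variable [i] of [All phi] being [i + 1] in [phi].
    The remaining connectives and the existential quantifier are definable,
    the logic being classical. *)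

Inductive term (S : language) (n : nat) : Type :=
| Var of 'I_n
| App (f : fsym S) of ('I_(farity f) -> term S n).

Inductive formula (S : language) : nat -> Type :=
| Bot n : formula S n
| Eq n of term S n & term S n : formula S n
| Rel n (r : rsym S) of ('I_(rarity r) -> term S n) : formula S n
| Imp n of formula S n & formula S n : formula S n
| All n of formula S n.+1 : formula S n.

Fixpoint teval (S : language) (M : structure S) n (e : n.-tuple M)
    (t : term S n) : M :=
  match t with
  | Var i => tnth e i
  | App f ts => fun_interp [tuple teval e (ts i) | i < farity f]
  end.

Fixpoint sat (S : language) (M : structure S) n (phi : formula S n) :
    n.-tuple M -> Prop :=
  match phi in formula _ n0 return n0.-tuple M -> Prop with
  | Bot _ => fun _ => False
  | Eq _ t u => fun e => teval e t = teval e u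
  | Rel _ r ts => fun e => rel_interp [tuple teval e (ts i) | i < rarity r]
  | Imp _ p q => fun e => sat p e -> sat q e
  | All _ p => fun e => forall x : M, sat p [tuple of x :: e]
  end.

(** [M] is identified with its image in [N] under [h]. *)
Definition elementary (S : language) (M N : structure S) (h : M -> N) : Prop :=
  forall n (phi : formula S n) (e : n.-tuple M),
    sat phi e <-> sat phi (map_tuple h e).

(** A set of formulas in [x_0, ..., x_{n-1}] with parameters in [M]: the
    formula phi(x, b) is given by [phi : formula S (n + m)] and
    [b : m.-tuple M]. *)
Definition formula_set (S : language) (M : structure S) (n : nat) :=
  forall m, formula S (n + m) -> m.-tuple M -> Prop.

Definition tp (S : language) (M N : structure S) (h : M -> N) n
    (a : n.-tuple N) : formula_set M n :=
  fun m phi b => sat phi [tuple of a ++ map_tuple h b].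

(** The tuple [c] lists the parameters of the defining formula [delta]. *)
Definition definable_type (S : language) (M : structure S) n
    (p : formula_set M n) : Prop :=
  forall m (phi : formula S (n + m)),
    exists k (delta : formula S (m + k)) (c : k.-tuple M),
      forall b : m.-tuple M, p m phi b <-> sat delta [tuple of b ++ c].

Definition T (S : language) (n : nat) (M N : structure S) (h : M -> N) : Prop :=
  forall a : n.-tuple N, definable_type (tp h a).

(** * Ordered abelian groups *)

HB.mixin Record isOrderedGroup G of Num.POrderedZmodule G := {
  le_total_og : total (<=%R : rel G);
  le_add2l_og : forall z x y : G, x <= y -> z + x <= z + y }.

#[short(type="orderedGroupType")]
HB.structure Definition OrderedGroup :=
  {G of isOrderedGroup G & Num.POrderedZmodule G}.

Inductive og_fsym := OgZero | OgAdd | OgOpp.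

Inductive og_rsym := OgLt.

Definition og_language : language := {|
  farity := fun f => match f with OgZero => 0 | OgAdd => 2 | OgOpp => 1 end%N;
  rarity := fun r => match r with OgLt => 2 end%N |}.

Definition og_structure (G : orderedGroupType) : structure og_language :=
  @Structure og_language G
    (fun f => match f return (@farity og_language f).-tuple G -> G with
       | OgZero => fun _ => 0
       | OgAdd => fun t => tnth t ord0 + tnth t ord_max
       | OgOpp => fun t => - tnth t ord0
       end)
    (fun r => match r return (@rarity og_language r).-tuple G -> Prop with
       | OgLt => fun t => tnth t ord0 < tnth t ord_max
       end).

(** * Valued fields *)

(** [option G] stands for the group with a largest element adjoined: [None] is
    infinity. *)

Section WithInfinity.
Variable G : orderedGroupType.

Definition vadd (a b : option G) : option G :=
  if a is Some x then (if b is Some y then Some (x + y) else None) else None.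

Definition vle (a b : option G) : bool :=
  if b is Some y then (if a is Some x then x <= y else false) else true.

Definition vmin (a b : option G) : option G := if vle a b then a else b.

End WithInfinity.

(** By surjectivity [G] is the value group. *)
Record valuation (K : fieldType) (G : orderedGroupType) := Valuation {
  val_fun :> K -> option G;
  val_infty : forall x, val_fun x = None <-> x = 0;
  val_mul : forall x y, val_fun (x * y) = vadd (val_fun x) (val_fun y);
  val_add : forall x y, vle (vmin (val_fun x) (val_fun y)) (val_fun (x + y));
  val_surj : forall g : G, exists x, val_fun x = Some g }.

Definition nontrivial (K : fieldType) (G : orderedGroupType)
    (v : valuation K G) : Prop :=
  exists x : K, x <> 0 /\ v x <> Some 0.

Inductive vf_fsym := VfZero | VfOne | VfAdd | VfOpp | VfMul.

Inductive vf_rsym := VfDiv.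

Definition vf_language : language := {|
  farity := fun f => match f with
    | VfZero => 0 | VfOne => 0 | VfAdd => 2 | VfOpp => 1 | VfMul => 2
    end%N;
  rarity := fun r => match r with VfDiv => 2 end%N |}.

Definition vf_structure (K : fieldType) (G : orderedGroupType)
    (v : valuation K G) : structure vf_language :=
  @Structure vf_language K
    (fun f => match f return (@farity vf_language f).-tuple K -> K with
       | VfZero => fun _ => 0
       | VfOne => fun _ => 1
       | VfAdd => fun t => tnth t ord0 + tnth t ord_max
       | VfOpp => fun t => - tnth t ord0
       | VfMul => fun t => tnth t ord0 * tnth t ord_max
       end)
    (fun r => match r return (@rarity vf_language r).-tuple K -> Prop with
       | VfDiv => fun t => vle (v (tnth t ord0)) (v (tnth t ord_max))
       end).

(** * Extensions of valued fields *)

(** [j] is the inclusion of value groups induced by the inclusion [iota]. *)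
Definition valued_extension (K L : fieldType) (GK GL : orderedGroupType)
    (vK : valuation K GK) (vL : valuation L GL)
    (iota : {rmorphism K -> L}) (j : {additive GK -> GL}) : Prop :=
  {mono j : a b / a <= b} /\ forall x : K, vL (iota x) = omap j (vK x).

Section Separated.
Variables (K L : fieldType) (iota : {rmorphism K -> L}).

Definition lincomb n (k : n.-tuple K) (y : n.-tuple L) : L :=
  \sum_(i < n) iota (tnth k i) * tnth y i.

Definition in_span n (x : n.-tuple L) (z : L) : Prop :=
  exists k : n.-tuple K, z = lincomb k x.

Definition lin_indep n (y : n.-tuple L) : Prop :=
  forall k : n.-tuple K, lincomb k y = 0 -> forall i, tnth k i = 0.

Definition basis_of_span n m (x : n.-tuple L) (y : m.-tuple L) : Prop :=
  (forall z, in_span x z <-> in_span y z) /\ lin_indep y.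

Variables (G : orderedGroupType) (v : valuation L G).

Definition separated_seq n (y : n.-tuple L) : Prop :=
  forall k : n.-tuple K,
    v (lincomb k y) = \big[@vmin G/None]_(i < n) v (iota (tnth k i) * tnth y i).

Definition separated_extension : Prop :=
  forall n (x : n.-tuple L),
    exists m (y : m.-tuple L), basis_of_span x y /\ separated_seq y.

End Separated.

(* Main.v *)
(** Write x <= y for v(x) <= v(y).  The sets defined by boolean combinations of
    conditions P <= Q between polynomials are closed under projection, in every
    algebraically closed non-trivially valued field.  For a variable t, given a
    definable family of polynomials, let r be the root nearest to t: the values
    of the polynomials at t are the minima of those of the monomials of their
    expansions at r, so t = r + u may be replaced by r + z u' with z a generic
    unit and v(u') one of finitely many midpoints between the radii at which two
    monomials have the same value.  It remains to project along the roots of a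
    polynomial F(y, -): the number of roots r with C(r) < O(r) is read off from
    the coefficients of prod_r (W + C(r) T + O(r)), which are polynomials in the
    coefficients of F, and inclusion-exclusion counts the roots in any definable
    set.

    If L/K is separated, v(P(a, b)) is, for a in L and b over K, a minimum of
    terms v(q(b)) + v(y) with q over K, so tp(a/K) is definable as soon as the
    cuts of vK realised in vL are.  Conversely, if all types are definable, then
    the trace on K of a definable subset of L is definable.  For T_1(vK, vL) one
    applies this to the inverse image under v of a definable set, and tests it
    at generic points of K, where polynomials take the values of their
    monomials.  For separatedness, a vector without closest vector in a
    separated subspace yields a definable chain of balls in K with empty
    intersection, and there is none: beyond a certain ball, the radius
    of every ball of the chain would be one of finitely many. *)
From HB Require Import structures.
From mathcomp Require Import all_boot all_order all_algebra.
From mathcomp Require Import ring zify.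
From Stdlib Require Import Classical.
Require Import Defs.

Set Implicit Arguments.
Unset Strict Implicit.
Unset Printing Implicit Defensive.

Import Order.TTheory GRing.Theory Num.Theory.
Local Open Scope ring_scope.

(* [dv x y] stands for v(x) <= v(y): every value is the value of an element,
   so the value group is never mentioned. *)
Record vdiv (K : fieldType) := Vdiv {
  dv :> rel K;
  dv_total : total dv;
  dv_trans : transitive dv;
  dvx0 : forall x, dv x 0;
  dv0x : forall x, dv 0 x -> x = 0;
  dv_mul2r : forall z x y, z != 0 -> dv (x * z) (y * z) = dv x y;
  dv_add : forall z x y, dv z x -> dv z y -> dv z (x + y) }.

(** * Calculation with values and the ultrametric inequality *)

Section Vdiv.
Variables (K : fieldType) (D : vdiv K).
Implicit Types x y z : K.

Definition sdv x y := ~~ D y x.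
Definition eqdv x y := D x y && D y x.

Lemma dvxx x : D x x. Proof. by have := dv_total D x x; rewrite orbb. Qed.

Lemma sdvW x y : sdv x y -> D x y.
Proof. by have := dv_total D x y; rewrite /sdv; case: (D y x); rewrite ?orbF. Qed.

Lemma sdv_dv_trans x y z : sdv x y -> D y z -> sdv x z.
Proof. by move=> xy yz; apply: contra xy; apply: dv_trans. Qed.

Lemma dv_sdv_trans x y z : D x y -> sdv y z -> sdv x z.
Proof. by move=> xy; apply: contra => zx; apply: dv_trans xy. Qed.

Lemma sdv_neq0 x y : sdv x y -> x != 0.
Proof. by apply: contraNneq => ->; apply: dvx0. Qed.

Lemma dv_neq0 x y : D x y -> y != 0 -> x != 0.
Proof. by move=> xy; apply: contraNneq => x0; move: xy; rewrite x0 => /dv0x ->. Qed.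

Lemma dv_mul2l z x y : z != 0 -> D (z * x) (z * y) = D x y.
Proof. by move=> z0; rewrite ![z * _]mulrC dv_mul2r. Qed.

Lemma dv_mul x y x' y' : D x y -> D x' y' -> D (x * x') (y * y').
Proof.
move=> xy xy'; case: (eqVneq x' 0) xy' => [-> /dv0x ->|x'0 xy'].
  by rewrite !mulr0 dvxx.
have [->|y0] := eqVneq y 0; first by rewrite mul0r dvx0.
by apply: dv_trans (_ : D (y * x') _); rewrite ?dv_mul2r ?dv_mul2l.
Qed.

Lemma sdv_mul x y x' y' : sdv x y -> D x' y' -> x' != 0 -> sdv (x * x') (y * y').
Proof.
move=> xy xy' x'0; apply: sdv_dv_trans (_ : D (y * x') _); last exact: dv_mul (dvxx _) _.
by rewrite /sdv dv_mul2r.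
Qed.

Lemma sdv_mul2r z x y : z != 0 -> sdv (x * z) (y * z) = sdv x y.
Proof. by move=> z0; rewrite /sdv dv_mul2r. Qed.

Lemma sdv_mul2l z x y : z != 0 -> sdv (z * x) (z * y) = sdv x y.
Proof. by move=> z0; rewrite /sdv dv_mul2l. Qed.

Lemma dv1N : D 1 (-1).
Proof.
have m0 : (-1 : K) != 0 by rewrite oppr_eq0 oner_eq0.
case/orP: (dv_total D 1 (-1)) => // h.
by rewrite -(dv_mul2r D _ _ m0) mulN1r opprK mul1r.
Qed.

Lemma dvNr x y : D x (- y) = D x y.
Proof.
have hN a b : D a b -> D a (- b).
  by move=> ab; rewrite -mulN1r -[a]mul1r; apply: dv_mul dv1N ab.
by apply/idP/idP => [/hN|/hN //]; rewrite opprK.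
Qed.

Lemma dvNl x y : D (- x) y = D x y.
Proof.
have m0 : (-1 : K) != 0 by rewrite oppr_eq0 oner_eq0.
by rewrite -[RHS](dv_mul2r D _ _ m0) !mulrN1 dvNr.
Qed.

Lemma dv_sub z x y : D z x -> D z y -> D z (x - y).
Proof. by move=> zx zy; rewrite dv_add ?dvNr. Qed.

Lemma dvBC z x y : D z (x - y) = D z (y - x).
Proof. by rewrite -dvNr opprB. Qed.

Lemma dvBCl z x y : D (x - y) z = D (y - x) z.
Proof. by rewrite -dvNl opprB. Qed.

Lemma dv_sum I (r : seq I) (Q : pred I) (F : I -> K) z :
  (forall i, Q i -> D z (F i)) -> D z (\sum_(i <- r | Q i) F i).
Proof.
by move=> h; elim/big_ind: _ => [|x y|//]; [apply: dvx0 | apply: dv_add].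
Qed.

Lemma sdv_add z x y : sdv z x -> sdv z y -> sdv z (x + y).
Proof.
move=> zx zy; case/orP: (dv_total D x y) => h.
  by apply: sdv_dv_trans zx _; apply: dv_add; rewrite ?dvxx.
by apply: sdv_dv_trans zy _; apply: dv_add; rewrite ?dvxx.
Qed.

Lemma sdv_sum I (r : seq I) (Q : pred I) (F : I -> K) z : z != 0 ->
  (forall i, Q i -> sdv z (F i)) -> sdv z (\sum_(i <- r | Q i) F i).
Proof.
move=> z0 h; elim/big_ind: _ => [|x y|//]; last exact: sdv_add.
by apply: contra z0 => /dv0x ->.
Qed.

(** If v(x + y) exceeded v(x), then x = (x + y) - y would be a sum of two elements of value larger
    than v(x). *)
Lemma eqdv_add x y : sdv x y -> eqdv (x + y) x.
Proof.
move=> xy; apply/andP; split; last by rewrite dv_add ?dvxx ?sdvW.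
apply/negPn/negP => h.
have : sdv x (x + y - y) by apply: sdv_add => //; rewrite /sdv dvNl.
by rewrite addrK /sdv dvxx.
Qed.

Lemma dvX n x y : D x y -> D (x ^+ n) (y ^+ n).
Proof. by move=> xy; elim: n => [|n IH]; rewrite ?expr0 ?dvxx // !exprS dv_mul. Qed.

Lemma sdvX n x y : sdv x y -> sdv (x ^+ n.+1) (y ^+ n.+1).
Proof.
move=> xy; rewrite !exprS; apply: sdv_mul => //; first by apply/dvX/sdvW.
by rewrite expf_neq0 // (sdv_neq0 xy).
Qed.

Lemma dvXE n x y : D (x ^+ n.+1) (y ^+ n.+1) = D x y.
Proof. by apply/idP/idP => [|/dvX //]; apply: contraTT; apply: sdvX. Qed.

Lemma eqdv_refl x : eqdv x x. Proof. by rewrite /eqdv dvxx. Qed.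

Lemma eqdv_sym x y : eqdv x y = eqdv y x. Proof. by rewrite /eqdv andbC. Qed.

Lemma eqdv_trans x y z : eqdv x y -> eqdv y z -> eqdv x z.
Proof.
move=> /andP[xy yx] /andP[yz zy].
by rewrite /eqdv (dv_trans xy yz) (dv_trans zy yx).
Qed.

Lemma eqdv_mul x y x' y' : eqdv x y -> eqdv x' y' -> eqdv (x * x') (y * y').
Proof. by move=> /andP[xy yx] /andP[xy' yx']; rewrite /eqdv !dv_mul. Qed.

Lemma eqdvX n x y : eqdv x y -> eqdv (x ^+ n) (y ^+ n).
Proof. by case/andP=> xy yx; rewrite /eqdv !dvX. Qed.

Lemma eqdv_dvl x y z : eqdv x y -> D x z = D y z.
Proof.
by case/andP=> xy yx; apply/idP/idP; [apply: dv_trans yx | apply: dv_trans xy].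
Qed.

Lemma eqdv_dvr x y z : eqdv x y -> D z x = D z y.
Proof.
by case/andP=> xy yx; apply/idP/idP => h; [apply: dv_trans h xy | apply: dv_trans h yx].
Qed.

Lemma eqdv_sdvl x y z : eqdv x y -> sdv x z = sdv y z.
Proof. by move=> h; rewrite /sdv (eqdv_dvr z h). Qed.

Lemma eqdv_eq0 x y : eqdv x y -> (x == 0) = (y == 0).
Proof.
by case/andP=> xy yx; apply/eqP/eqP => [x0|y0]; apply: (@dv0x _ D);
  rewrite -?x0 -?y0.
Qed.

Lemma seq_extremum (R : rel K) (S : seq K) (Q : pred K) :
  total R -> transitive R -> has Q S ->
  exists2 w, (w \in S) && Q w & forall x, x \in S -> Q x -> R w x.
Proof.
move=> tR trR; have reflR x : R x x by have := tR x x; rewrite orbb.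
elim: S => //= a S IH; have [/IH [w /andP[wS Qw] hw] _|nS] := boolP (has Q S).
  have [Qa|nQa] := boolP (Q a); last first.
    exists w; first by rewrite inE wS orbT.
    by move=> x; rewrite inE => /predU1P[-> /(negP nQa)//|/hw].
  case/orP: (tR w a) => h.
    exists w; first by rewrite inE wS orbT.
    by move=> x; rewrite inE => /predU1P[->|/hw].
  exists a; first by rewrite inE eqxx.
  move=> x; rewrite inE => /predU1P[-> //|/hw h' /h'].
  exact: trR.
rewrite orbF => Qa; exists a; first by rewrite inE eqxx.
move=> x; rewrite inE => /predU1P[-> //|xS Qx].
by case/hasP: nS; exists x.
Qed.

Lemma dv_seq_min (S : seq K) (Q : pred K) : has Q S ->
  exists2 w, (w \in S) && Q w & forall x, x \in S -> Q x -> D w x.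
Proof. by apply: seq_extremum; [apply: dv_total | apply: dv_trans]. Qed.

Lemma dv_seq_max (S : seq K) (Q : pred K) : has Q S ->
  exists2 w, (w \in S) && Q w & forall x, x \in S -> Q x -> D x w.
Proof.
apply: (@seq_extremum (fun x y => D y x)) => [x y|y x z yx zy].
  exact: dv_total.
exact: dv_trans zy yx.
Qed.

(** * The Gauss valuation *)

(** The first index at which the coefficients reach their least value: the order at 0 of the
    reduction of [p], once [p] is scaled to Gauss value 0. *)
Definition isind (p : {poly K}) (a : nat) :=
  p`_a != 0 /\ forall j, D p`_a p`_j /\ ((j < a)%N -> sdv p`_a p`_j).

Lemma isind_uniq p a b : isind p a -> isind p b -> a = b.
Proof.
move=> [_ ha] [_ hb]; apply/eqP; rewrite eqn_leq; apply/andP; split.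
  by rewrite leqNgt; apply/negP => /(ha b).2; rewrite /sdv (hb a).1.
by rewrite leqNgt; apply/negP => /(hb a).2; rewrite /sdv (ha b).1.
Qed.

(** Gauss's lemma: in the coefficient of index [a + b], p_a q_b is the only term of least value; in
    those of smaller index all terms have larger value. *)
Lemma isindM p q a b : isind p a -> isind q b ->
  isind (p * q) (a + b) /\ eqdv (p * q)`_(a + b) (p`_a * q`_b).
Proof.
move=> [pa ha] [qb hb].
have ab0 : p`_a * q`_b != 0 by rewrite mulf_neq0.
have e : eqdv (p * q)`_(a + b) (p`_a * q`_b).
  have lt_a : (a < (a + b).+1)%N by rewrite ltnS leq_addr.
  rewrite coefM (bigD1 (Ordinal lt_a)) //= addKn; apply: eqdv_add.
  apply: sdv_sum => // -[i lti] /=; rewrite -val_eqE /= => ne.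
  case: (ltngtP i a) ne => // h _.
    apply: sdv_mul => //; [exact: (ha i).2 | exact: (hb _).1].
  rewrite mulrC [X in sdv _ X]mulrC; apply: sdv_mul => //; last exact: (ha i).1.
  by apply: (hb _).2; rewrite ltn_subLR ?ltn_add2r.
split=> //; split; first by rewrite (eqdv_eq0 e).
move=> j; rewrite (eqdv_dvl _ e) (eqdv_sdvl _ e) coefM; split.
  by apply: dv_sum => i _; apply: dv_mul; [apply: (ha _).1 | apply: (hb _).1].
move=> ltj; apply: sdv_sum => // -[i lti] _ /=.
have [h|h] := ltnP i a; first by apply: sdv_mul => //; [apply: (ha i).2 | apply: (hb _).1].
rewrite mulrC [X in sdv _ X]mulrC; apply: sdv_mul => //; last exact: (ha i).1.
by apply: (hb _).2; rewrite ltn_subLR // (leq_trans ltj) ?leq_add2r.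
Qed.

(** The boolean [sdv a b] is read as 0 or 1, so that by [isindM] the index of a product of linear
    factors counts the factors with v(a) < v(b). *)
Lemma isind_linear a b : a != 0 \/ b != 0 -> isind (a *: 'X + b%:P) (sdv a b).
Proof.
move=> ab; have c0 : (a *: 'X + b%:P)`_0 = b.
  by rewrite coefD coefZ coefX mulr0 add0r coefC.
have c1 : (a *: 'X + b%:P)`_1 = a.
  by rewrite coefD coefZ coefX mulr1 coefC addr0.
have c2 j : (1 < j)%N -> (a *: 'X + b%:P)`_j = 0.
  by case: j => [|[|j]] // _; rewrite coefD coefZ coefX mulr0 coefC addr0.
have [sab|] := boolP (sdv a b); rewrite /isind /= ?c0 ?c1.
  split; first exact: sdv_neq0 sab.
  by case=> [|[|j]]; rewrite ?c0 ?c1 ?c2 ?dvxx ?dvx0 ?(sdvW sab).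
rewrite negbK => ba; split.
  by case: ab => // a0; apply: dv_neq0 ba a0.
by case=> [|[|j]]; rewrite ?c0 ?c1 ?c2 ?dvxx ?dvx0.
Qed.

(* The value of [p] at [u] is the Gauss value of [p] for the radius v([u]). *)
Definition gauss_at (p : {poly K}) (u : K) :=
  forall z, D z p.[u] <-> forall j, D z (p`_j * u ^+ j).

Lemma gauss_at0 u : gauss_at 0 u.
Proof. by move=> z; rewrite horner0; split=> [_ j|_]; rewrite ?coef0 ?mul0r dvx0. Qed.

(** Since v(u - s) <= v(u), there is no cancellation in u - s, whose value is the lesser of v(u) and
    v(s). Gauss's lemma carries this over to the product. *)
Lemma gauss_at_prod_XsubC (c : K) (ss : seq K) (u : K) : u != 0 ->
  (forall s, s \in ss -> D (u - s) u) ->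
  gauss_at (c *: \prod_(s <- ss) ('X - s%:P)) u.
Proof.
move=> u0 hs.
have [->|c0] := eqVneq c 0; first by rewrite scale0r; apply: gauss_at0.
(* [sc p] is p(uX), which reduces the radius v(u) to 0. *)
pose sc (p : {poly K}) := \poly_(j < size p) (p`_j * u ^+ j).
have scE p j : (sc p)`_j = p`_j * u ^+ j.
  by rewrite coef_poly; case: ltnP => // h; rewrite nth_default // mul0r.
have scM p q : sc (p * q) = sc p * sc q.
  apply/polyP => j; rewrite scE !coefM mulr_suml; apply: eq_bigr => -[i lti] _ /=.
  by rewrite !scE mulrACA -exprD subnKC.
suff [a [ia ea]] : exists a, isind (sc (c *: \prod_(s <- ss) ('X - s%:P))) a /\
    eqdv (c *: \prod_(s <- ss) ('X - s%:P)).[u] (sc (c *: \prod_(s <- ss) ('X - s%:P)))`_a.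
  move=> z; rewrite (eqdv_dvr _ ea); split=> [h j|].
    by rewrite -scE; apply: dv_trans h (ia.2 j).1.
  by move/(_ a); rewrite -scE.
elim: ss hs => [_|s ss IH hs].
  exists 0%N; rewrite big_nil scE hornerZ hornerC coefZ coef1 /= expr0 !mulr1.
  split; last exact: eqdv_refl.
  split; first by rewrite scE coefZ coef1 expr0 !mulr1.
  by move=> j; rewrite !scE !coefZ !coef1 expr0 !mulr1; case: j => [|j];
    rewrite ?mulr0 ?mul0r ?mulr1 ?dvxx ?dvx0.
case: IH => [s' hs'|a [ia ea]]; first by apply: hs; rewrite inE hs' orbT.
have hus : D (u - s) u by apply: hs; rewrite inE eqxx.
have i1 : isind (sc ('X - s%:P)) (sdv u s).
  have -> : sc ('X - s%:P) = u *: 'X + (- s)%:P.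
    apply/polyP => j; rewrite scE coefB coefX coefC coefD coefZ coefX coefC.
    case: j => [|[|j]] /=; first by rewrite expr0 !(mulr0, mulr1, sub0r, add0r).
      by rewrite expr1 !(mulr1, subr0, addr0) mul1r.
    by rewrite !(mulr0, subr0, addr0) mul0r.
  have -> : sdv u s = sdv u (- s) by rewrite /sdv dvNl.
  by apply: isind_linear; left.
have [i2 e2] := isindM i1 ia.
have -> : c *: \prod_(s <- s :: ss) ('X - s%:P) =
    ('X - s%:P) * (c *: \prod_(s <- ss) ('X - s%:P)) by rewrite big_cons scalerAr.
exists (sdv u s + a)%N; rewrite scM; split=> //.
rewrite hornerM; apply: eqdv_trans (eqdv_mul _ ea) _; last by rewrite eqdv_sym; exact: e2.
rewrite !hornerE scE coefB coefX coefC; have [h|] := boolP (sdv u s) => /=.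
  rewrite subr0 mul1r expr1; apply: eqdv_add.
  by rewrite /sdv dvNl.
rewrite negbK sub0r expr0 mulr1 => su; rewrite /eqdv dvNl dvNr; apply/andP; split.
  have [us|] := boolP (D u s); first exact: dv_trans hus us.
  move=> nus; have := eqdv_add (_ : sdv (- s) u).
  by rewrite /sdv dvNr => /(_ nus) /andP[]; rewrite addrC dvNr.
by rewrite dv_sub // dvxx.
Qed.

End Vdiv.

(** * Generic units *)

Section Units.
Variables (K : closedFieldType) (D : vdiv K).
Implicit Types (p : {poly K}) (x y z u s : K) (Z ss : seq K).

(** Units with pairwise distinct residues, expressed without the residue field. *)
Definition unit_seq Z :=
  [/\ uniq Z, forall z, z \in Z -> eqdv D z 1
    & forall z z', z \in Z -> z' \in Z -> z != z' -> D (z - z') 1].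

(* Euclid's trick: a root of [X * prod (X - z) + 1] is incongruent to all of
   [0] and the [z]. *)
Lemma unit_seq_exists n : exists2 Z, unit_seq Z & size Z = n.
Proof.
elim: n => [|n [Z [uZ hZ dZ] sZ]]; first by exists nil.
pose Z0 := 0 :: Z; pose q := \prod_(z <- Z0) ('X - z%:P) + 1.
have szq : size q = n.+2.
  rewrite size_polyDl size_prod_XsubC /= sZ // size_poly1 //.
have /closed_rootP[x] : size q != 1%N by rewrite szq.
rewrite /root /q hornerD hornerC horner_prod addr_eq0 => /eqP hx.
have {}hx : eqdv D (\prod_(z <- Z0) (x - z)) 1.
  have -> : \prod_(z <- Z0) (x - z) = -1.
    by rewrite -hx; apply: eq_bigr => z _; rewrite !hornerE.
  by rewrite /eqdv dvNl dvNr dvxx.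
have Z0le z : z \in Z0 -> D 1 z.
  by rewrite inE => /predU1P[->|/hZ/andP[]//]; apply: dvx0.
(* If v(x) < 0, all factors x - z have the value v(x), and their product is not a unit. *)
have x_int : D 1 x.
  apply/negPn/negP => nx.
  have hle z : z \in Z0 -> D (x - z) x && D x (x - z).
    move=> zZ; rewrite andbC; suff: eqdv D (x - z) x by rewrite eqdv_sym.
    apply: eqdv_add; rewrite /sdv dvNl.
    by apply: contra nx => /(dv_trans (Z0le _ zZ)).
  have : forall S : seq K, {subset S <= Z0} -> S != [::] ->
      sdv D (\prod_(z <- S) (x - z)) 1.
    elim=> // a [|b S] IH hS _; have ha := hle a (hS a (mem_head _ _)).
      rewrite big_seq1; apply: dv_sdv_trans nx; by case/andP: ha.
    have {}IH : sdv D (\prod_(z <- b :: S) (x - z)) 1.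
      by apply: IH => // c cS; apply: hS; rewrite inE cS orbT.
    rewrite big_cons -[X in sdv _ _ X]mulr1; apply: sdv_mul (sdvW IH) (sdv_neq0 IH).
    by apply: dv_sdv_trans nx; case/andP: ha.
  by move=> /(_ Z0 (fun _ h => h) isT); case/andP: hx => _ h; rewrite /sdv h.
have hle z : z \in Z0 -> D 1 (x - z) by move=> zZ; apply: dv_sub x_int (Z0le _ zZ).
(* A factor of positive value would make the product a non-unit, the other factors being
   integral. *)
have hge z : z \in Z0 -> D (x - z) 1.
  move=> zZ; apply/negPn/negP => nz.
  suff: sdv D 1 (\prod_(z <- Z0) (x - z)) by rewrite /sdv; case/andP: hx => ->.
  have hS : {subset rem z Z0 <= Z0} by apply: mem_rem.
  rewrite (big_rem z zZ); move: (rem z Z0) hS => S hS /=.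
  rewrite -[X in sdv _ X _]mulr1; apply: sdv_mul nz _ (oner_neq0 _).
  elim: S hS => [_|a S IH hS]; first by rewrite big_nil dvxx.
  rewrite big_cons -[X in D X _]mulr1; apply: dv_mul.
    by apply: hle; apply: hS; rewrite mem_head.
  by apply: IH => c cS; apply: hS; rewrite inE cS orbT.
exists (x :: Z); last by rewrite /= sZ.
have xnot z : z \in Z -> x != z.
  move=> zZ; apply/eqP => e; have := hge z; rewrite inE zZ orbT e subrr.
  by move=> /(_ isT) /dv0x/eqP; rewrite oner_eq0.
split=> [|z|z z'] /=.
- by rewrite uZ andbT; apply/negP => /xnot /eqP.
- rewrite inE => /predU1P[->|/hZ//].
  by have := hge 0 (mem_head _ _); rewrite subr0 /eqdv x_int andbT.
rewrite !inE => /predU1P[->|zZ] /predU1P[->|z'Z]; rewrite ?eqxx // => ne.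
- by apply: hge; rewrite inE z'Z orbT.
- by rewrite dvBCl; apply: hge; rewrite inE zZ orbT.
exact: dZ.
Qed.

(** Each [s] is congruent to at most one element of [Z], since two such elements would be congruent
    to each other. *)
Lemma unit_seq_avoid Z ss : unit_seq Z -> (size ss < size Z)%N ->
  exists2 z, z \in Z & forall s, s \in ss -> D (z - s) 1.
Proof.
elim: ss Z => [|s ss IH] Z [uZ hZ dZ].
  by case: Z {uZ hZ dZ} => // z Z _; exists z; rewrite ?mem_head.
move=> /= ltZ; pose Z' := [seq z <- Z | D (z - s) 1].
have sub z : z \in Z' -> z \in Z by rewrite mem_filter => /andP[].
case: (IH Z') => [||z zZ' hz].
- split=> [|z /sub/hZ//|z z' /sub zZ /sub]; first exact: filter_uniq.
  exact: dZ.
- rewrite -ltnS; apply: leq_trans ltZ _.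
  rewrite -(count_predC (fun z => D (z - s) 1)) size_filter -addn1 leq_add2l.
  have : uniq (filter (predC (fun z => D (z - s) 1)) Z) by apply: filter_uniq.
  rewrite -size_filter; have : {subset filter (predC (fun z => D (z - s) 1)) Z <=
    [pred z in Z | ~~ D (z - s) 1]} by move=> z; rewrite mem_filter andbC.
  case: (filter _ Z) => [|a [|b S]] //= hS; rewrite inE negb_or => /andP[/andP[ab _] _].
  have /andP[aZ ha] := hS a (mem_head _ _).
  have /andP[bZ hb] : b \in [pred z in Z | ~~ D (z - s) 1].
    by apply: hS; rewrite !inE eqxx orbT.
  have := dZ _ _ aZ bZ ab; apply: contraLR => _.
  have -> : a - b = (a - s) + (s - b) by ring.
  by apply: sdv_add => //; rewrite /sdv dvBCl.
exists z; first exact: sub.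
move=> s'; rewrite inE => /predU1P[->|/hz//].
by move: zZ'; rewrite mem_filter => /andP[].
Qed.

Lemma generic_unit Z ss u : unit_seq Z -> u != 0 -> (size ss < size Z)%N ->
  exists2 z, z \in Z & forall s, s \in ss -> D (z * u - s) (z * u).
Proof.
move=> hZ u0 lt; have [|z zZ hz] := @unit_seq_avoid Z [seq s / u | s <- ss] hZ.
  by rewrite size_map.
exists z => // s sS; have [_ /(_ z zZ) e _] := hZ.
have -> : z * u - s = (z - s / u) * u by rewrite mulrBl divfK.
rewrite dv_mul2r //; apply: dv_trans (_ : D 1 z); last by case/andP: e.
by apply: hz; apply/mapP; exists s.
Qed.

(** The field is infinite, as it contains unit sequences of any length. *)
Lemma poly_ext_eq0 p : (forall x, p.[x] = 0) -> p = 0.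
Proof.
move=> h; apply/eqP/negPn/negP => p0.
have [Z [uZ _ _] sZ] := unit_seq_exists (size p).
have /(max_poly_roots p0) : all (root p) Z.
  by apply/allP => z _; rewrite /root h.
by move=> /(_ uZ); rewrite sZ ltnn.
Qed.

Lemma poly_ext p q : (forall x, p.[x] = q.[x]) -> p = q.
Proof.
move=> h; apply/eqP; rewrite -subr_eq0; apply/eqP/poly_ext_eq0 => x.
by rewrite hornerD hornerN h subrr.
Qed.

(** Roots are listed with multiplicity; the zero polynomial is given none. *)
Definition roots_of p := if p == 0 then [::] else sval (closed_field_poly_normal p).

Lemma roots_ofE p : p = lead_coef p *: \prod_(s <- roots_of p) ('X - s%:P).
Proof.
rewrite /roots_of; case: eqP => [->|_]; first by rewrite lead_coef0 scale0r.
by case: closed_field_poly_normal.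
Qed.

Lemma mem_roots_of p s : p != 0 -> (s \in roots_of p) = root p s.
Proof.
move=> p0; rewrite [in RHS](roots_ofE p) rootZ ?lead_coef_eq0 //.
by rewrite root_prod_XsubC.
Qed.

Lemma size_roots_of p : size (roots_of p) = (size p).-1.
Proof.
have [->|p0] := eqVneq p 0; first by rewrite /roots_of eqxx size_poly0.
rewrite [in RHS](roots_ofE p) size_scale ?lead_coef_eq0 //.
by rewrite size_prod_XsubC.
Qed.

Lemma gauss_at_generic p u : u != 0 ->
  (forall s, s \in roots_of p -> D (u - s) u) -> gauss_at D p u.
Proof.
by move=> u0 h; rewrite (roots_ofE p); apply: gauss_at_prod_XsubC.
Qed.

Lemma nth_root_exists n (x : K) : exists y, y ^+ n.+1 = x.
Proof.
have : size ('X^(n.+1) - x%:P : {poly K}) != 1%N.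
  by rewrite size_polyDl size_polyXn // size_polyN size_polyC; case: eqP.
case/closed_rootP => y /rootP; rewrite !hornerE => /eqP.
by rewrite subr_eq0 => /eqP; exists y.
Qed.

End Units.

(** * Quantifier-free definable sets *)

(* Plays the role of the polynomial functions in the free variables. *)
Record fring (K : fieldType) (E : Type) := Fring {
  fr :> (E -> K) -> Prop;
  fr_ext : forall f g, (forall y, f y = g y) -> fr f -> fr g;
  fr_cst : forall c, fr (fun=> c);
  fr_add : forall f g, fr f -> fr g -> fr (fun y => f y + g y);
  fr_mul : forall f g, fr f -> fr g -> fr (fun y => f y * g y) }.

Section Fring.
Variables (K : fieldType) (E : Type) (P : fring K E).

Lemma fr_opp f : P f -> P (fun y => - f y).
Proof.
move=> Pf; apply: fr_ext (fr_mul (fr_cst P (-1)) Pf) => y; exact: mulN1r.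
Qed.

Lemma fr_sub f g : P f -> P g -> P (fun y => f y - g y).
Proof. by move=> Pf Pg; apply: fr_add Pf (fr_opp Pg). Qed.

Lemma fr_exp n f : P f -> P (fun y => f y ^+ n).
Proof.
move=> Pf; elim: n => [|n IH]; first exact: fr_cst.
by apply: fr_ext (fr_mul Pf IH) => y; rewrite exprS.
Qed.

Lemma fr_sum I (r : seq I) (Q : pred I) (F : I -> E -> K) :
  (forall i, P (F i)) -> P (fun y => \sum_(i <- r | Q i) F i y).
Proof.
move=> h; elim: r => [|i r IH].
  by apply: fr_ext (fr_cst P 0) => y; rewrite big_nil.
have [Qi|nQi] := boolP (Q i).
  by apply: fr_ext (fr_add (h i) IH) => y; rewrite big_cons Qi.
by apply: fr_ext IH => y; rewrite big_cons (negPf nQi).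
Qed.

Lemma fr_prod I (r : seq I) (Q : pred I) (F : I -> E -> K) :
  (forall i, P (F i)) -> P (fun y => \prod_(i <- r | Q i) F i y).
Proof.
move=> h; elim: r => [|i r IH].
  by apply: fr_ext (fr_cst P 1) => y; rewrite big_nil.
have [Qi|nQi] := boolP (Q i).
  by apply: fr_ext (fr_mul (h i) IH) => y; rewrite big_cons Qi.
by apply: fr_ext IH => y; rewrite big_cons (negPf nQi).
Qed.

Lemma fr_det n (M : E -> 'M[K]_n) : (forall i j, P (fun y => M y i j)) ->
  P (fun y => \det (M y)).
Proof.
by move=> h; apply: fr_sum => s; apply: fr_mul; [apply: fr_cst | apply: fr_prod].
Qed.

(** The uniform degree bound turns conditions on all coefficients into finite conjunctions. *)
Definition polyc (p : E -> {poly K}) :=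
  (exists n, forall y, (size (p y) <= n)%N) /\ forall j, P (fun y => (p y)`_j).

Lemma polycC f : P f -> polyc (fun y => (f y)%:P).
Proof.
move=> Pf; split; first by exists 1%N => y; rewrite size_polyC; case: eqP.
case=> [|j]; first by apply: fr_ext Pf => y; rewrite coefC.
by apply: fr_ext (fr_cst P 0) => y; rewrite coefC.
Qed.

Lemma polycX : polyc (fun=> 'X).
Proof. by split; [exists 2%N => y; rewrite size_polyX | move=> j; apply: fr_cst]. Qed.

Lemma polycD p q : polyc p -> polyc q -> polyc (fun y => p y + q y).
Proof.
move=> [[n hn] hp] [[m hm] hq]; split.
  exists (maxn n m) => y; apply: leq_trans (size_polyD _ _) _.
  by rewrite geq_max !leq_max hn hm orbT.
by move=> j; apply: fr_ext (fr_add (hp j) (hq j)) => y; rewrite coefD.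
Qed.

Lemma polycM p q : polyc p -> polyc q -> polyc (fun y => p y * q y).
Proof.
move=> [[n hn] hp] [[m hm] hq]; split.
  exists (n + m)%N => y; apply: leq_trans (size_polyMleq _ _) _.
  by rewrite (leq_trans (leq_pred _)) // leq_add.
move=> j; apply: fr_ext (fr_sum _ _ (fun i : 'I_j.+1 => fr_mul (hp i) (hq (j - i)%N))) => y.
by rewrite coefM.
Qed.

Lemma polycXn n : polyc (fun=> 'X^n).
Proof. by split; [exists n.+1 => y; rewrite size_polyXn | move=> j; apply: fr_cst]. Qed.

(** The ring P[t], for one further variable t, as functions on pairs. *)
Definition ext_pred (f : E * K -> K) :=
  exists2 p, polyc p & forall e, f e = (p e.1).[e.2].

Fact ext_ext f g : (forall y, f y = g y) -> ext_pred f -> ext_pred g.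
Proof. by move=> e [p hp h]; exists p => // y; rewrite -e. Qed.

Fact ext_cst c : ext_pred (fun=> c).
Proof.
exists (fun=> c%:P) => [|e]; last by rewrite hornerC.
exact: polycC (fr_cst P c).
Qed.

Fact ext_add f g : ext_pred f -> ext_pred g -> ext_pred (fun y => f y + g y).
Proof.
move=> [p hp ep] [q hq eq]; exists (fun y => p y + q y); first exact: polycD.
by move=> e; rewrite hornerD ep eq.
Qed.

Fact ext_mul f g : ext_pred f -> ext_pred g -> ext_pred (fun y => f y * g y).
Proof.
move=> [p hp ep] [q hq eq]; exists (fun y => p y * q y); first exact: polycM.
by move=> e; rewrite hornerM ep eq.
Qed.

Definition ext : fring K (E * K) := Fring ext_ext ext_cst ext_add ext_mul.

Lemma ext_fst f : P f -> ext (fun e => f e.1).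
Proof.
by move=> Pf; exists (fun y => (f y)%:P) => [|e]; [apply: polycC | rewrite hornerC].
Qed.

Lemma ext_snd : ext snd.
Proof. by exists (fun=> 'X) => [|e]; [apply: polycX | rewrite hornerX]. Qed.

End Fring.

Lemma horner_bound (K : fieldType) (p : {poly K}) n x : (size p <= n)%N ->
  p.[x] = \sum_(i < n) p`_i * x ^+ i.
Proof. by move=> h; rewrite (horner_coef_wide _ h). Qed.

Lemma fr_horner (K : fieldType) E (P : fring K E) p h :
  polyc P p -> P h -> P (fun y => (p y).[h y]).
Proof.
move=> [[n hn] hp] Ph.
apply: fr_ext (fr_sum _ _ (fun i : 'I_n => fr_mul (hp i) (fr_exp i Ph))) => y.
by rewrite (horner_bound _ (hn y)).
Qed.

Lemma polyc_comp (K : fieldType) E E' (P : fring K E) (P' : fring K E') (pi : E' -> E) p :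
  (forall f, P f -> P' (fun y => f (pi y))) -> polyc P p -> polyc P' (fun y => p (pi y)).
Proof.
by move=> h [[n hn] hp]; split; [exists n => y | move=> j; apply: h (hp j)].
Qed.

Lemma ext_comp (K : fieldType) E E' (P : fring K E) (P' : fring K E')
    (pi : E' -> E) (h : E' -> K) f :
  (forall g, P g -> P' (fun y => g (pi y))) -> P' h -> ext P f ->
  P' (fun y => f (pi y, h y)).
Proof.
move=> hpi Ph [p hp e]; apply: fr_ext (fr_horner (polyc_comp hpi hp) Ph) => y.
by rewrite e.
Qed.

(** * Boolean combinations of comparisons *)

Section Qf.
Variables (K : fieldType) (D : vdiv K).

(** [qf_iff] allows passing to equivalent predicates without extensionality. *)
Inductive qf E (P : fring K E) : (E -> Prop) -> Prop :=
| qf_dv p q : P p -> P q -> qf P (fun y => D (p y) (q y))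
| qf_not A : qf P A -> qf P (fun y => ~ A y)
| qf_and A B : qf P A -> qf P B -> qf P (fun y => A y /\ B y)
| qf_iff A B : (forall y, A y <-> B y) -> qf P A -> qf P B.

Section Closure.
Variables (E : Type) (P : fring K E).

Lemma qf_or A B : qf P A -> qf P B -> qf P (fun y => A y \/ B y).
Proof.
move=> hA hB; apply: qf_iff (qf_not (qf_and (qf_not hA) (qf_not hB))) => y.
by split; [case: (classic (A y)); case: (classic (B y)); tauto | tauto].
Qed.

Lemma qf_imp A B : qf P A -> qf P B -> qf P (fun y => A y -> B y).
Proof.
move=> hA hB; apply: qf_iff (qf_or (qf_not hA) hB) => y.
by case: (classic (A y)); tauto.
Qed.

Lemma qf_sdv p q : P p -> P q -> qf P (fun y => sdv D (p y) (q y)).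
Proof.
by move=> Pp Pq; apply: qf_iff (qf_not (qf_dv Pq Pp)) => y; split => /negP.
Qed.

Lemma qf_eq0 p : P p -> qf P (fun y => p y = 0).
Proof.
move=> Pp; apply: qf_iff (qf_dv (fr_cst P 0) Pp) => y; split; first exact: dv0x.
by move->; apply: dvxx.
Qed.

Lemma qf_neq0 p : P p -> qf P (fun y => p y != 0).
Proof. by move=> /qf_eq0/qf_not; apply: qf_iff => y; split => /eqP. Qed.

Lemma qf_true : qf P (fun=> True).
Proof. by apply: qf_iff (qf_dv (fr_cst P 0) (fr_cst P 0)) => y; rewrite dvxx. Qed.

(** Classically, [Q] is true or false; arbitrary conditions on fixed data can thus enter a
    definition. *)
Lemma qf_cst (Q : Prop) : qf P (fun=> Q).
Proof.
case: (classic Q) => h; first by apply: qf_iff qf_true.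
by apply: qf_iff (qf_not qf_true) => y; tauto.
Qed.

Lemma qf_ex_fin (I : finType) (Q : I -> Prop) (A : I -> E -> Prop) :
  (forall i, qf P (A i)) -> qf P (fun y => exists2 i, Q i & A i y).
Proof.
move=> h; suff : forall s : seq I, qf P (fun y => exists2 i, i \in s /\ Q i & A i y).
  move=> /(_ (enum I)); apply: qf_iff => y; split=> [[i [_ ?]]|[i]]; first by exists i.
  by exists i => //; rewrite mem_enum.
elim=> [|a s IH]; first by apply: qf_iff (qf_cst False) => y; split=> // -[i []].
apply: qf_iff (qf_or (qf_and (qf_cst (Q a)) (h a)) IH) => y; split.
  case=> [[? ?]|[i [si ?] ?]]; first by exists a; rewrite ?mem_head.
  by exists i; rewrite // inE si orbT.
case=> i [/predU1P[->|si] Qi Ai]; first by left.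
by right; exists i.
Qed.

Lemma qf_ex (I : finType) (A : I -> E -> Prop) :
  (forall i, qf P (A i)) -> qf P (fun y => exists i, A i y).
Proof.
move=> /(qf_ex_fin (fun=> True)); apply: qf_iff => y.
by split=> [[i _]|[i]]; exists i.
Qed.

Lemma qf_all (I : finType) (A : I -> E -> Prop) :
  (forall i, qf P (A i)) -> qf P (fun y => forall i, A i y).
Proof.
move=> h; have := qf_not (qf_ex (fun i => qf_not (h i))); apply: qf_iff => y.
split=> [ne i|hi [i]]; last by apply.
by apply: NNPP => ni; apply: ne; exists i.
Qed.

Lemma qf_poly_eq0 p : polyc P p -> qf P (fun y => p y = 0).
Proof.
move=> [[n hn] hp]; have := qf_all (fun i : 'I_n => qf_eq0 (hp i)).
apply: qf_iff => y; split=> [h|->i]; last by rewrite coef0.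
apply/polyP => j; rewrite coef0; have [lt|ge] := ltnP j n; first exact: (h (Ordinal lt)).
by rewrite nth_default // (leq_trans (hn y)).
Qed.

(** This lets a point be moved without leaving the set, as long as finitely many comparisons are
    preserved. *)
Lemma qf_finite A : qf P A -> exists (I : finType) (p : I -> E -> K),
  (forall i, P (p i)) /\ forall y y',
    (forall i j, D (p i y) (p j y) = D (p i y') (p j y')) -> A y <-> A y'.
Proof.
elim=> {A} [p q Pp Pq|A _ [I [p [Pp hp]]]|A B _ [I [p [Pp hp]]] _ [J [q [Pq hq]]]
  |A B e _ [I [p [Pp hp]]]].
- exists bool, (fun b => if b then p else q); split; first by case.
  by move=> y y' /(_ true false) /= ->.
- by exists I, p; split=> // y y' /hp; tauto.
- exists (I + J)%type, (fun k => match k with inl i => p i | inr j => q j end); split.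
    by case.
  move=> y y' h; have [h1 h2] := (hp y y' (fun i j => h (inl i) (inl j)),
    hq y y' (fun i j => h (inr i) (inr j))); tauto.
- by exists I, p; split=> // y y' /hp; rewrite -!e.
Qed.

End Closure.

Lemma qf_comp E E' (P : fring K E) (P' : fring K E') (h : E' -> E) A :
  (forall f, P f -> P' (fun y => f (h y))) -> qf P A -> qf P' (fun y => A (h y)).
Proof.
move=> hh; elim=> {A} [p q Pp Pq|A _ IH|A B _ IHA _ IHB|A B e _ IH].
- by apply: qf_dv; apply: hh.
- exact: qf_not.
- exact: qf_and.
- by apply: qf_iff IH => y; apply: e.
Qed.

End Qf.

(** * Norms from the ring of polynomial functions *)

(** Factoring [p] reduces the claim to X - s, where the determinant is, up to sign, the value of the
    characteristic polynomial at s. *)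
Lemma det_horner_mx (K : closedFieldType) n (A : 'M[K]_n.+1) (rs : seq K) (p : {poly K}) :
  char_poly A = \prod_(r <- rs) ('X - r%:P) ->
  \det (horner_mx A p) = \prod_(r <- rs) p.[r].
Proof.
move=> hA; have sz : size rs = n.+1.
  by have := size_char_poly A; rewrite hA size_prod_XsubC => -[].
have lin s : \det (horner_mx A ('X - s%:P)) = \prod_(r <- rs) (r - s).
  have -> : \prod_(r <- rs) (r - s) = (-1) ^+ n.+1 * (char_poly A).[s].
    rewrite hA horner_prod -sz; elim: (rs) => [|r rs' IH]; first by rewrite !big_nil mulr1.
    by rewrite !big_cons IH /= hornerXsubC exprS -[r - s]opprB -[- (s - r)]mulN1r mulrACA.
  rewrite rmorphB /= horner_mx_X horner_mx_C -opprB -scaleN1r detZ; congr (_ * _).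
  rewrite /char_poly -[RHS]/(horner_eval s _) -det_map_mx; congr (\det _).
  apply/matrixP => i j; rewrite !mxE /= /horner_eval.
  by rewrite hornerD hornerMn hornerX hornerN hornerC.
rewrite (roots_ofE p); elim: (roots_of p) => [|s ss IH].
  rewrite big_nil alg_polyC horner_mx_C det_scalar; under eq_bigr do rewrite hornerC.
  by rewrite big_const_seq count_predT sz iter_mulr_1.
rewrite big_cons scalerAr rmorphM detM lin IH -big_split /=.
by apply: eq_bigr => r _; rewrite hornerM hornerXsubC.
Qed.

(* [companionmx] in a format that does not depend on the polynomial. *)
Definition companion (K : fieldType) n (p : {poly K}) : 'M[K]_n.+1 :=
  \matrix_(i, j) if i == n :> nat then - p`_j else (i.+1 == j :> nat)%:R.

Lemma char_poly_companion (K : fieldType) n (p : {poly K}) :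
  p \is monic -> size p = n.+2 -> char_poly (companion n p) = p.
Proof.
move=> mp sz; rewrite -[RHS](companionmxK mp) /companionmx.
suff : forall d, d = n.+1 -> char_poly (companion n p) = char_poly
    (\matrix_(i < d, j < d) if i == d.-1 :> nat then - p`_j else (i.+1 == j :> nat)%:R).
  by apply; rewrite sz.
by move=> d ->.
Qed.

Section Norm.
Variables (K : closedFieldType) (E : Type) (P : fring K E).

Definition splits_as (p : {poly K}) n (rs : seq K) :=
  p = \prod_(r <- rs) ('X - r%:P) /\ size rs = n.

(** The product is the norm of [p y] from K[X]/(F y), the determinant of [p y] evaluated at the
    companion matrix, hence polynomial in the coefficients. *)
Lemma norm_fr n (F p : E -> {poly K}) : polyc P F -> polyc P p ->
  exists2 g, P g & forall y rs, splits_as (F y) n.+1 rs ->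
    g y = \prod_(r <- rs) (p y).[r].
Proof.
move=> [_ hF] [[m hm] hp].
pose M y := companion n (F y).
have hM i j : P (fun y => M y i j).
  case: (eqVneq (i : nat) n) => h.
    by apply: fr_ext (fr_opp (hF j)) => y; rewrite mxE h eqxx.
  by apply: fr_ext (fr_cst P (i.+1 == j :> nat)%:R) => y; rewrite mxE (negPf h).
have hMX k i j : P (fun y => (M y ^+ k) i j).
  elim: k i j => [|k IH] i j; first exact: fr_cst.
  apply: fr_ext (fr_sum _ _ (fun l => fr_mul (hM i l) (IH l j))) => y.
  by rewrite exprS !mxE.
exists (fun y => \det (\sum_(k < m) (p y)`_k *: M y ^+ k)).
  apply: fr_det => i j.
  apply: fr_ext (fr_sum _ _ (fun k : 'I_m => fr_mul (hp k) (hMX k i j))) => y.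
  by rewrite summxE; apply: eq_bigr => k _; rewrite !mxE.
move=> y rs [Fy sz]; have cM : char_poly (M y) = \prod_(r <- rs) ('X - r%:P).
  by rewrite char_poly_companion // Fy ?monic_prod_XsubC // size_prod_XsubC sz.
rewrite -(det_horner_mx _ cM); congr (\det _).
have {2}-> : p y = \sum_(k < m) (p y)`_k *: 'X^k.
  rewrite -poly_def; apply/polyP => k; rewrite coef_poly; case: ltnP => // h.
  by rewrite nth_default // (leq_trans (hm y)).
rewrite linear_sum; apply: eq_bigr => k _.
by rewrite linearZ /= rmorphXn /= horner_mx_X.
Qed.

End Norm.

(** * Counting roots *)

Section Count.
Variables (K : closedFieldType) (D : vdiv K).

(* The lowest nonzero coefficient in the outer variable is the product of the
   factors [c r * T + o r] that do not vanish, whose [isind] is the number of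
   [r] such that v([c r]) < v([o r]). *)
Definition count_poly (rs : seq K) (c o : K -> K) : {poly {poly K}} :=
  \prod_(r <- rs) ('X + (c r *: 'X + (o r)%:P)%:P).

Definition isind2 (Q : {poly {poly K}}) k m :=
  (forall i, (i < k)%N -> Q`_i = 0) /\ isind D Q`_k m.

Lemma isind2_uniq Q k m k' m' : isind2 Q k m -> isind2 Q k' m' -> m = m'.
Proof.
have neq0 i j : isind D Q`_i j -> Q`_i != 0.
  by case=> h _; apply: contraNneq h => ->; rewrite coef0.
move=> [h1 i1] [h2 i2]; case: (ltngtP k k') => [lt|lt|e].
- by move: (neq0 _ _ i1); rewrite h2 ?eqxx.
- by move: (neq0 _ _ i2); rewrite h1 ?eqxx.
by rewrite e in i1; apply: isind_uniq i1 i2.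
Qed.

Lemma isind2M Q Q' k m k' m' : isind2 Q k m -> isind2 Q' k' m' ->
  isind2 (Q * Q') (k + k') (m + m').
Proof.
move=> [h1 i1] [h2 i2].
have e : (Q * Q')`_(k + k') = Q`_k * Q'`_k'.
  have lt_k : (k < (k + k').+1)%N by rewrite ltnS leq_addr.
  rewrite coefM (bigD1 (Ordinal lt_k)) //= addKn big1 ?addr0 // => -[i lti] /=.
  rewrite -val_eqE /= => ne; case: (ltngtP i k) ne => // h _.
    by rewrite h1 ?mul0r.
  by rewrite h2 ?mulr0 // ltn_subLR ?ltn_add2r.
split; last by rewrite e; apply: (isindM i1 i2).1.
move=> j lt; rewrite coefM big1 // => -[i lti] _ /=.
have [h|h] := ltnP i k; first by rewrite h1 ?mul0r.
by rewrite h2 ?mulr0 // ltn_subLR // (leq_trans lt) ?leq_add2r.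
Qed.

Lemma isind2_count rs c o : exists2 k, (k <= size rs)%N &
  isind2 (count_poly rs c o) k (count (fun r => sdv D (c r) (o r)) rs).
Proof.
elim: rs => [|r rs [k le_k IH]] /=.
  exists 0%N => //; rewrite /count_poly big_nil; split=> //; rewrite coef1 /=.
  have := @isind_linear _ D 0 1 (or_intror (oner_neq0 _)).
  by rewrite scale0r add0r /sdv dvx0.
(* If c r = o r = 0, the factor is the outer variable alone: it raises the order [k] and leaves the
   count unchanged. *)
have [/andP[/eqP c0 /eqP o0]|nco] := boolP ((c r == 0) && (o r == 0)).
  exists k.+1 => //; rewrite /count_poly big_cons c0 o0 scale0r addr0 addr0.
  rewrite -add1n; apply: isind2M IH.
  rewrite /sdv dvxx; split; first by case=> // _; rewrite coefX.
  have := @isind_linear _ D 0 1 (or_intror (oner_neq0 _)).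
  by rewrite scale0r add0r /sdv dvx0 coefX.
exists k; first exact: leqW.
rewrite /count_poly big_cons -[k]add0n; apply: isind2M IH; split=> //.
rewrite coefD coefX coefC add0r; apply: isind_linear.
by case/nandP: nco; [left | right].
Qed.

Variables (E : Type) (P : fring K E) (F : E -> {poly K}) (n : nat).
Hypothesis polycF : polyc P F.
Let dom y rs := splits_as (F y) n.+1 rs.

(** With T and W as two further variables, the norm of T C + O + W along the roots of [F] is
    polynomial in T and W; comparison at all T and W identifies the coefficients. *)
Lemma count_poly_coef (C O : E * K -> K) k : ext P C -> ext P O ->
  exists2 g, polyc P g & forall y rs, dom y rs ->
    (count_poly rs (fun r => C (y, r)) (fun r => O (y, r)))`_k = g y.
Proof.
move=> [c pc ec] [o po eo]; pose P2 := ext (ext P).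
have pull f : P f -> P2 (fun e => f e.1.1).
  by move=> Pf; apply: ext_fst (ext_fst Pf).
have PT : P2 (fun e => e.1.2) by apply: ext_fst (ext_snd P).
have PW : P2 (fun e => e.2) by apply: ext_snd.
have hp : polyc P2 (fun e => (e.1.2)%:P * c e.1.1 + o e.1.1 + (e.2)%:P).
  apply: polycD (polycC PW); apply: polycD (polyc_comp pull po).
  by apply: polycM (polycC PT) (polyc_comp pull pc).
have [G [q [[N hN] hq] eG] hG] := norm_fr n (polyc_comp pull polycF) hp.
have [g hg eg] := hq k; exists g => // y rs hy; apply: poly_ext => // T.
rewrite -(eg (y, T)).
have -> : q (y, T) = \prod_(r <- rs) ('X + (T * C (y, r) + O (y, r))%:P).
  apply: (poly_ext D) => W; have /= := eG ((y, T), W); rewrite (hG _ rs) //= => <-.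
  rewrite horner_prod; apply: eq_bigr => r _; rewrite !hornerE ec eo /=; ring.
rewrite -[LHS]/(horner_eval T _) -coef_map /count_poly rmorph_prod /=.
congr (_`_k); under eq_bigr => r _.
  rewrite rmorphD /= map_polyX map_polyC /= /horner_eval hornerD hornerZ hornerX hornerC mulrC.
  over.
by [].
Qed.

Lemma qf_isind g m : polyc P g -> qf D P (fun y => isind D (g y) m).
Proof.
move=> [[N hN] hg]; have pm := hg m.
have := qf_and (qf_neq0 D pm) (qf_all (fun j : 'I_N => qf_and (qf_dv D pm (hg j))
  (qf_imp (qf_cst D P (j < m)%N) (qf_sdv D pm (hg j))))).
apply: qf_iff => y; split=> -[g0 h]; split=> // j.
have [lt|ge] := ltnP j N; first exact: (h (Ordinal lt)).
rewrite [(g y)`_j]nth_default ?(leq_trans (hN y)) // dvx0; split=> // lt.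
by case/eqP: g0; rewrite nth_default // (leq_trans (hN y)) // (leq_trans ge) // ltnW.
Qed.

(** The order in the outer variable is at most the number [n.+1] of roots, so that it is sought in
    ['I_n.+2]. *)
Lemma qf_count (C O : E * K -> K) m : ext P C -> ext P O ->
  exists2 A, qf D P A & forall y rs, dom y rs ->
    (A y <-> count (fun r => sdv D (C (y, r)) (O (y, r))) rs = m).
Proof.
move=> hC hO.
have /fin_all_exists [g hg] : forall k : 'I_n.+2, exists g, polyc P g /\
    forall y rs, dom y rs ->
    (count_poly rs (fun r => C (y, r)) (fun r => O (y, r)))`_k = g y.
  by move=> k; have [g g1 g2] := count_poly_coef k hC hO; exists g.
exists (fun y => exists k : 'I_n.+2,
    (forall i : 'I_n.+2, (i < k)%N -> g i y = 0) /\ isind D (g k y) m).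
  apply: qf_ex => k; apply: qf_and; last by apply: qf_isind; case: (hg k).
  apply: qf_all => i; apply: qf_imp; first exact: qf_cst.
  by apply: qf_poly_eq0; case: (hg i).
move=> y rs hy.
have [k le_k hk] := isind2_count rs (fun r => C (y, r)) (fun r => O (y, r)).
have sz : size rs = n.+1 by case: hy.
rewrite sz -ltnS in le_k; split.
  move=> [k' [h1 h2]]; apply: (isind2_uniq (k' := k') hk); split; last first.
    by rewrite ((hg k').2 _ _ hy).
  move=> i lti; have lti' : (i < n.+2)%N by apply: ltn_trans lti _.
  by have := (hg (Ordinal lti')).2 y rs hy => /= ->; apply: h1.
move=> em; rewrite em in hk; case: hk => h1 h2.
exists (Ordinal le_k); split; last by rewrite -((hg (Ordinal le_k)).2 _ _ hy).
by move=> i lti; rewrite -((hg i).2 _ _ hy); apply: h1.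
Qed.

(** Boundedness makes the case distinctions of [qfval_op] finite. *)
Definition qfval (s : E -> seq K -> int) :=
  (exists B : nat, forall y rs, dom y rs -> `|s y rs|%N <= B)%N /\
  forall m, exists2 A, qf D P A & forall y rs, dom y rs -> (A y <-> s y rs = m).

Lemma qfval_op (f : int -> int -> int) s1 s2 s : qfval s1 -> qfval s2 ->
  (exists B : nat, forall y rs, dom y rs -> `|s y rs|%N <= B)%N ->
  (forall y rs, dom y rs -> s y rs = f (s1 y rs) (s2 y rs)) -> qfval s.
Proof.
move=> [[B1 b1] h1] [[B2 b2] h2] b e; split=> // m.
(* [v B] enumerates the integers from -B to B. *)
pose v B (i : 'I_(B + B).+1) : int := i%:Z - B%:Z.
have vP B x : (`|x| <= B)%N -> exists i, v B i = x.
  move=> h; have lt : (`|(x + B%:Z)%R| < (B + B).+1)%N by lia.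
  by exists (Ordinal lt); rewrite /v /=; lia.
have /fin_all_exists2[A1 q1 e1] := fun i => h1 (v B1 i).
have /fin_all_exists2[A2 q2 e2] := fun i => h2 (v B2 i).
exists (fun y => exists i, exists2 j, f (v B1 i) (v B2 j) = m & A1 i y /\ A2 j y).
  by apply: qf_ex => i; apply: qf_ex_fin => j; apply: qf_and.
move=> y rs hy; rewrite e //; split.
  by move=> [i [j <- [/(e1 i y rs hy) -> /(e2 j y rs hy) ->]]].
have [i ei] := vP _ _ (b1 _ _ hy); have [j ej] := vP _ _ (b2 _ _ hy).
move=> <-; exists i, j; rewrite ?ei ?ej //; split; first by apply/(e1 i y rs hy).
by apply/(e2 j y rs hy).
Qed.

(** The comparison with 0 says that [C e] is nonzero; for empty [I] this is the whole condition. *)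
Definition bas (I : finType) (C : E * K -> K) (O : I -> E * K -> K) e : bool :=
  sdv D (C e) 0 && [forall i, sdv D (C e) (O i e)].

Lemma count_le_size (a : pred K) y rs : dom y rs -> (`|(count a rs)%:Z|%N <= n.+1)%N.
Proof. by move=> [_ <-]; apply: count_size. Qed.

(* For a generic unit [z], [\sum z^i O_i] has the least of the values of the
   [O_i], at all roots; for other [z] it has a larger value. *)
Lemma qfval_bas (I : finType) (C : E * K -> K) (O : I -> E * K -> K) :
  ext P C -> (forall i, ext P (O i)) ->
  qfval (fun y rs => (count (fun r => bas C O (y, r)) rs)%:Z).
Proof.
move=> hC hO.
pose Oz z e := \sum_(i : I) z ^+ (enum_rank i) * O i e.
have hOz z : ext P (Oz z).
  by apply: fr_sum => i; apply: fr_mul (hO i); apply: fr_cst.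
pose cnt z y rs := count (fun r => sdv D (C (y, r)) (Oz z (y, r))) rs.
(* Each of the n + 1 roots [r] yields a polynomial [p r] of size at most [#|I|], and [z] has to
   avoid the roots of all of them. *)
have [Z hZ sZ] := unit_seq_exists D (n.+1 * #|I|).+1.
have le_cnt z y rs : z \in Z -> (count (fun r => bas C O (y, r)) rs <= cnt z y rs)%N.
  move=> zZ; apply: sub_count => r /andP[C0 /forallP h]; apply: sdv_sum => [|i _].
    exact: sdv_neq0 C0.
  have [_ /(_ z zZ) e _] := hZ.
  rewrite -[C _]mul1r mulrC [X in sdv _ _ X]mulrC; apply: sdv_mul => //.
    have /andP[_] := eqdvX (enum_rank i) e; by rewrite expr1n.
  exact: oner_neq0.
have eq_cnt y rs : dom y rs ->
    exists2 z, z \in Z & count (fun r => bas C O (y, r)) rs = cnt z y rs.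
  move=> [_ srs]; pose p r := \sum_(i : I) O i (y, r) *: 'X^(enum_rank i) : {poly K}.
  have szp r : (size (p r) <= #|I|)%N.
    apply: leq_trans (size_sum _ _ _) _; apply/bigmax_leqP => i _.
    by apply: leq_trans (size_scale_leq _ _) _; rewrite size_polyXn.
  pose ss := flatten [seq roots_of (p r) | r <- rs].
  have [|z zZ hz] := @generic_unit _ D Z ss 1 hZ (oner_neq0 _).
    rewrite sZ ltnS -srs /ss; elim: (rs) => //= r s IH.
    rewrite size_cat mulSn leq_add // size_roots_of (leq_trans (leq_pred _)) //.
  rewrite mulr1 in hz.
  have [_ /(_ z zZ) ez _] := hZ.
  have z0 : z != 0 by rewrite (eqdv_eq0 ez) oner_neq0.
  exists z => //; apply: eq_in_count => r rsr.
  have gz : gauss_at D (p r) z.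
    apply: gauss_at_generic => // s sr; apply: hz; apply/flattenP.
    by exists (roots_of (p r)) => //; apply: map_f.
  have pz : Oz z (y, r) = (p r).[z].
    by rewrite horner_sum; apply: eq_bigr => i _; rewrite !hornerE mulrC.
  have cp i : (p r)`_(enum_rank i) = O i (y, r).
    rewrite coef_sum (bigD1 i) //= coefZ coefXn eqxx mulr1 big1 ?addr0 // => j ne.
    rewrite coefZ coefXn; case: eqP => [/ord_inj/enum_rank_inj ji|]; last by rewrite mulr0.
    by rewrite ji eqxx in ne.
  apply/idP/idP => [/andP[C0 /forallP h]|].
    apply: sdv_sum => [|i _]; first exact: sdv_neq0 C0.
    rewrite -[C _]mul1r mulrC [X in sdv _ _ X]mulrC; apply: sdv_mul => //.
      by have /andP[_] := eqdvX (enum_rank i) ez; rewrite expr1n.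
    exact: oner_neq0.
  move=> h; apply/andP; split; first exact: sdv_dv_trans h (dvx0 _ _).
  apply/forallP => i; apply: sdv_dv_trans h _; rewrite pz.
  have /(gz _)/(_ (enum_rank i)) := dvxx D (p r).[z].
  rewrite cp => h; apply: dv_trans h _; rewrite -[X in D _ X]mulr1; apply: dv_mul (dvxx _ _) _.
  by have /andP[] := eqdvX (enum_rank i) ez; rewrite expr1n.
have qc z : qfval (fun y rs => (cnt z y rs)%:Z).
  split; first by exists n.+1 => y rs; apply: count_le_size.
  move=> [m|m]; last by exists (fun=> False) => [|y rs _]; [apply: qf_cst | split].
  have [A qA hA] := qf_count m hC (hOz z); exists A => // y rs /hA ->.
  by rewrite /cnt; split=> [->|[]].
(* The count is the minimum of the [cnt z] over [Z]; the start value [n.+1] bounds all counts. *)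
suff : forall S, qfval (fun y rs => (foldr (fun z m => minn (cnt z y rs) m) n.+1 S)%:Z).
  move=> /(_ Z) [bd h]; split; first by exists n.+1 => y rs; apply: count_le_size.
  move=> m; have [A qA hA] := h m; exists A => // y rs hy; rewrite (hA y rs hy).
  suff -> : foldr (fun z m => minn (cnt z y rs) m) n.+1 Z =
    count (fun r => bas C O (y, r)) rs by [].
  have [z zZ ez] := eq_cnt y rs hy.
  apply/eqP; rewrite eqn_leq; apply/andP; split.
    rewrite ez; elim: (Z) zZ => //= a S IH; rewrite inE => /predU1P[->|/IH h'].
      exact: geq_minl.
    by apply: leq_trans (geq_minr _ _) h'.
  have : {subset Z <= Z} by [].
  elim: {1 3}(Z) => [_|a S IH hS] /=; first exact: (count_le_size _ hy).
  rewrite leq_min IH ?andbT; last by move=> b bS; apply: hS; rewrite inE bS orbT.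
  by apply: le_cnt; apply: hS; rewrite mem_head.
elim=> [|a S IH] /=.
  split; first by exists n.+1.
  by move=> m; exists (fun=> n.+1%:Z = m) => //; apply: qf_cst.
apply: (qfval_op (f := fun a b : int => (minn `|a|%N `|b|%N)%:Z) (qc a) IH); last first.
  by move=> y rs _; rewrite !absz_nat.
exists n.+1 => y rs hy; rewrite absz_nat (leq_trans (geq_minl _ _)) //.
exact: (count_le_size _ hy).
Qed.

(** The group generated by the indicator functions of the sets [bas]. It is closed under products
    and so contains the indicators of all quantifier-free sets, by inclusion-exclusion. *)
Inductive lin : (E * K -> int) -> Prop :=
| lin_bas (I : finType) (C : E * K -> K) (O : I -> E * K -> K) :
    ext P C -> (forall i, ext P (O i)) ->
    lin (fun e => (bas C O e : nat)%:Z)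
| lin_opp f : lin f -> lin (fun e => - f e)
| lin_add f g : lin f -> lin g -> lin (fun e => f e + g e)
| lin_eq f g : (forall e, f e = g e) -> lin f -> lin g.

(** For nonzero C and C', the conditions v(C) < v(O) and v(C') < v(O') amount to v(CC') < v(OC') and
    v(CC') < v(CO'). *)
Lemma lin_mul f g : lin f -> lin g -> lin (fun e => f e * g e).
Proof.
move=> lf lg; elim: lf => {f} [I C O hC hO|f _ IH|f h _ IHf _ IHh|f h e _ IH]; first last.
- by apply: lin_eq IH => x; rewrite e.
- by apply: lin_eq (lin_add IHf IHh) => x; rewrite mulrDl.
- by apply: lin_eq (lin_opp IH) => x; rewrite mulNr.
elim: lg => {g} [J C' O' hC' hO'|g _ IH|g h _ IHg _ IHh|g h e _ IH]; first last.
- by apply: lin_eq IH => x; rewrite e.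
- by apply: lin_eq (lin_add IHg IHh) => x; rewrite mulrDr.
- by apply: lin_eq (lin_opp IH) => x; rewrite mulrN.
pose O2 (k : I + J) e := match k with inl i => O i e * C' e | inr j => C e * O' j e end.
apply: (lin_eq (f := fun e => (@bas (I + J)%type (fun e => C e * C' e) O2 e : nat)%:Z)).
  move=> e; rewrite -PoszM mulnb; congr (nat_of_bool _)%:Z.
  have nz x : sdv D x 0 = (x != 0).
    by apply/idP/idP => [/sdv_neq0//|]; apply: contraNN => /dv0x ->.
  rewrite /bas !nz mulf_eq0 negb_or.
  have [C0|C0] := eqVneq (C e) 0; first by rewrite ?andbF.
  have [C'0|C'0] := eqVneq (C' e) 0; first by rewrite ?andbF.
  apply/forallP/andP => [h|[/forallP h1 /forallP h2] [i|j]] /=.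
  - split; apply/forallP => i.
      by have := h (inl i); rewrite /= sdv_mul2r.
    by have := h (inr i); rewrite /= sdv_mul2l.
  - by rewrite sdv_mul2r.
  - by rewrite sdv_mul2l.
by apply: lin_bas => [|[i|j]]; apply: fr_mul.
Qed.

(** The comparison v(p) <= v(q) is the complement of v(q) < v(p); complements and intersections
    become 1 - f and f g. *)
Lemma qf_lin S : qf D (ext P) S ->
  exists2 f, lin f & forall e, S e /\ f e = 1 \/ ~ S e /\ f e = 0.
Proof.
have lin1 : lin (fun=> 1).
  apply: lin_eq (lin_bas (fr_cst _ 1) (fun i : void => fr_cst _ 0)) => e.
  rewrite /bas; have -> : sdv D 1 0 by apply: contraNN (oner_neq0 K) => /dv0x ->.
  by have -> : [forall i : void, true] by apply/forallP.
elim=> {S} [p q hp hq|A _ [f lf hf]|A B _ [f lf hf] _ [g lg hg]|A B e _ [f lf hf]].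
- exists (fun e => 1 - (bas q (fun _ : unit => p) e : nat)%:Z).
    by apply: lin_add lin1 (lin_opp _); apply: lin_bas.
  move=> e; have [h|h] := boolP (D (p e) (q e)); [left|right]; split=> //.
    by rewrite /bas; have -> : [forall i : unit, sdv D (q e) (p e)] = false;
      rewrite ?andbF //; apply/forallP => /(_ tt); rewrite /sdv h.
  rewrite /bas; have -> : [forall i : unit, sdv D (q e) (p e)] by apply/forallP.
  by rewrite (sdv_dv_trans h) ?dvx0.
- exists (fun e => 1 - f e); first by apply: lin_add lin1 (lin_opp lf).
  by move=> e; case: (hf e) => -[? ->]; [right|left]; rewrite ?subrr ?subr0; tauto.
- exists (fun e => f e * g e); first exact: lin_mul.
  by move=> e; case: (hf e) => -[? ->]; case: (hg e) => -[? ->];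
    rewrite ?mulr1 ?mulr0; tauto.
- by exists f => // x; rewrite -e.
Qed.

Lemma qfval_lin f : lin f -> qfval (fun y rs => \sum_(r <- rs) f (y, r)).
Proof.
elim=> {f} [I C O hC hO|f _ [[B b] h]|f g _ IHf _ IHg|f g e _ IH].
- have [[B b] h] := qfval_bas hC hO.
  have ee y rs : \sum_(r <- rs) (bas C O (y, r) : nat)%:Z =
      (count (fun r => bas C O (y, r)) rs)%:Z.
    by elim: rs => [|r rs IH]; rewrite ?big_nil // big_cons IH.
  split; first by exists B => y rs /b; rewrite ee.
  by move=> m; have [A qA hA] := h m; exists A => // y rs /hA; rewrite ee.
- split; first by exists B => y rs /b; rewrite sumrN abszN.
  move=> m; have [A qA hA] := h (- m); exists A => // y rs /hA ->.
  by rewrite sumrN; split=> [->|<-]; rewrite opprK.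
- apply: (qfval_op (f := fun a b => a + b) IHf IHg).
    have [[B1 b1] _] := IHf; have [[B2 b2] _] := IHg.
    exists (B1 + B2)%N => y rs hy; rewrite big_split /=.
    move: (b1 _ _ hy) (b2 _ _ hy) => /=.
    by move: (\sum_(r <- rs) f _) (\sum_(r <- rs) g _) => a b; lia.
  by move=> y rs _; rewrite big_split.
- have [[B b] h] := IH.
  have ee y rs : \sum_(r <- rs) g (y, r) = \sum_(r <- rs) f (y, r).
    by apply: eq_bigr => r _; rewrite e.
  split; first by exists B => y rs /b; rewrite ee.
  by move=> m; have [A qA hA] := h m; exists A => // y rs /hA; rewrite ee.
Qed.

(** The sum over the roots of the indicator function of [S] counts the roots in [S]; the set sought
    is where it is not 0. *)
Lemma qf_ex_root_split S : qf D (ext P) S ->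
  exists2 A, qf D P A & forall y rs, dom y rs ->
    (A y <-> exists2 r, r \in rs & S (y, r)).
Proof.
move=> /qf_lin [f lf hf]; have [_ /(_ 0)[A qA hA]] := qfval_lin lf.
exists (fun y => ~ A y); first exact: qf_not.
move=> y rs hy; rewrite (hA y rs hy); split=> [ne|[r rsr Sr]].
  apply: NNPP => h; apply: ne; rewrite big_seq big1 // => r rsr.
  by case: (hf (y, r)) => -[Sr //]; case: h; exists r.
have f0 x : 0 <= f x by case: (hf x) => -[_ ->].
rewrite (big_rem r rsr) /=; have -> : f (y, r) = 1 by case: (hf (y, r)) => -[].
by move=> /eqP; rewrite eq_sym lt_eqF // ltr_pwDl // sumr_ge0.
Qed.

End Count.

(** * Inverting a coefficient *)

Section Localization.
Variables (K : closedFieldType) (D : vdiv K) (E : Type) (P : fring K E).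
Variables (c : E -> K).
Hypothesis Pc : P c.

(** The localisation P[1/c]; functions are constrained only where [c] does not vanish. *)
Definition loc_pred (f : E -> K) :=
  exists k, exists2 g, P g & forall y, c y != 0 -> f y = g y / c y ^+ k.

Fact loc_ext f g : (forall y, f y = g y) -> loc_pred f -> loc_pred g.
Proof. by move=> e [k [h Ph hh]]; exists k, h => // y cy; rewrite -e hh. Qed.

Lemma fr_loc f : P f -> loc_pred f.
Proof. by exists 0%N, f => // y _; rewrite expr0 divr1. Qed.

Fact loc_add f g : loc_pred f -> loc_pred g -> loc_pred (fun y => f y + g y).
Proof.
move=> [k [f' Pf hf]] [l [g' Pg hg]]; exists (k + l)%N.
exists (fun y => f' y * c y ^+ l + g' y * c y ^+ k).
  by apply: fr_add; apply: fr_mul; rewrite //; apply: fr_exp.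
move=> y cy; rewrite hf // hg // exprD.
have h1 : c y ^+ k != 0 by rewrite expf_neq0.
have h2 : c y ^+ l != 0 by rewrite expf_neq0.
by field; rewrite h1 h2.
Qed.

Fact loc_mul f g : loc_pred f -> loc_pred g -> loc_pred (fun y => f y * g y).
Proof.
move=> [k [f' Pf hf]] [l [g' Pg hg]]; exists (k + l)%N.
exists (fun y => f' y * g' y); first exact: fr_mul.
move=> y cy; rewrite hf // hg // exprD.
have h1 : c y ^+ k != 0 by rewrite expf_neq0.
have h2 : c y ^+ l != 0 by rewrite expf_neq0.
by field; rewrite h1 h2.
Qed.

Definition loc : fring K E :=
  Fring loc_ext (fun a => fr_loc (fr_cst P a)) loc_add loc_mul.

(** Both sides of a comparison are multiplied by a power of c to clear denominators. *)
Lemma qf_loc A : qf D loc A -> qf D P (fun y => c y != 0 /\ A y).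
Proof.
have Pc0 := qf_neq0 D Pc.
elim=> {A} [p q [k [p' Pp hp]] [l [q' Pq hq]]|A _ IH|A B _ IHA _ IHB|A B e _ IH].
- have := qf_and Pc0 (qf_dv D (fr_mul Pp (fr_exp l Pc)) (fr_mul Pq (fr_exp k Pc))).
  have e y : c y != 0 ->
      D (p y) (q y) = D (p' y * c y ^+ l) (q' y * c y ^+ k).
    move=> cy; rewrite hp // hq //.
    have h1 : c y ^+ k != 0 by rewrite expf_neq0.
    have h2 : c y ^+ l != 0 by rewrite expf_neq0.
    rewrite -(dv_mul2r D (p' y / _) (q' y / _) (mulf_neq0 h1 h2)).
    by rewrite mulrA divfK // mulrCA divfK // [c y ^+ k * _]mulrC.
  by apply: qf_iff => y; split=> -[cy h]; split=> //; move: h; rewrite e.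
- apply: qf_iff (qf_and Pc0 (qf_not IH)) => y; tauto.
- apply: qf_iff (qf_and IHA IHB) => y; tauto.
- by apply: qf_iff IH => y; rewrite e.
Qed.

End Localization.

(** * Projection along the roots of a polynomial *)

Section RootElimination.
Variables (K : closedFieldType) (D : vdiv K) (E : Type) (P : fring K E).

(** Where [F y] has degree [d], division by the leading coefficient makes it monic over the
    localisation. Finitely many degrees occur. *)
Lemma qf_ex_root F S : polyc P F -> qf D (ext P) S ->
  qf D P (fun y => F y != 0 /\ exists2 r, root (F y) r & S (y, r)).
Proof.
move=> [[N hN] hF] hS.
pose degree (d : 'I_N) y := (F y)`_d != 0 /\ forall j : 'I_N, (d < j)%N -> (F y)`_j = 0.
have qdeg d : qf D P (degree d).
  apply: qf_and; first exact: qf_neq0.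
  by apply: qf_all => j; apply: qf_imp (qf_cst _ _ _) (qf_eq0 _ _).
have sz d y : degree d y -> size (F y) = d.+1.
  move=> [d0 hd]; apply/eqP; rewrite eqn_leq; apply/andP; split; last first.
    by rewrite ltnNge; apply: contra d0 => h; rewrite nth_default.
  apply/leq_sizeP => j ltj; have [lt|ge] := ltnP j N; first exact: (hd (Ordinal lt)).
  by rewrite nth_default // (leq_trans (hN y)).
have /fin_all_exists2[A qA hA] : forall d : 'I_N, exists2 A, qf D P A & forall y,
    degree d y -> (A y <-> exists2 r, root (F y) r & S (y, r)).
  move=> d; pose c y := (F y)`_d; have Pc : P c := hF d.
  (* A nonzero constant has no root; otherwise the degree is the successor of [d.-1], as
     [qf_ex_root_split] requires. *)
  have [d0|d0] := posnP d.
    exists (fun=> False); first exact: qf_cst.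
    move=> y hy; split=> // -[r]; have := sz d y hy; rewrite d0.
    move/eqP/size_poly1P => [a a0 ->]; rewrite /root hornerC => /eqP a0'.
    by rewrite a0' eqxx in a0.
  pose F' y := (c y)^-1 *: F y.
  have pF' : polyc (loc Pc) F'.
    split; first by exists N => y; apply: leq_trans (size_scale_leq _ _) _.
    move=> j; exists 1%N, (fun y => (F y)`_j) => // y _.
    by rewrite coefZ expr1 mulrC.
  have hS' : qf D (ext (loc Pc)) S.
    apply: (@qf_comp K D _ _ (ext P) (ext (loc Pc)) id S _ hS) => f [p [bp hp] ep].
    by exists p => //; split=> // j; apply: fr_loc; apply: hp.
  have [A qA hA] := @qf_ex_root_split K D E (loc Pc) F' d.-1 pF' S hS'.
  exists (fun y => c y != 0 /\ A y); first exact: qf_loc.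
  move=> y hy; have [c0 _] := hy; have szF := sz d y hy.
  have F0 : F y != 0 by rewrite -size_poly_eq0 szF.
  have e : splits_as (F' y) d.-1.+1 (roots_of (F y)).
    rewrite prednK //; split; last by rewrite size_roots_of szF.
    rewrite /F' [in LHS](roots_ofE (F y)) scalerA.
    by rewrite /lead_coef szF /= mulVf // scale1r.
  split=> [[_ /(hA y _ e)[r]]|[r rr Sr]].
    by rewrite mem_roots_of // => rr Sr; exists r.
  by split=> //; apply/(hA y _ e); exists r; rewrite // mem_roots_of.
have := qf_ex (fun d => qf_and (qdeg d) (qA d)); apply: qf_iff => y; split.
  move=> [d [hd Ad]]; split; last by apply/(hA d).
  by rewrite -size_poly_eq0 (sz d y hd).
move=> [F0 h]; have lt : ((size (F y)).-1 < N)%N.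
  by apply: leq_trans (hN y); rewrite prednK // size_poly_gt0.
have hd : degree (Ordinal lt) y.
  split; first by rewrite /= -lead_coefE lead_coef_eq0.
  by move=> j /= ltj; rewrite nth_default // -[size _]prednK // size_poly_gt0.
by exists (Ordinal lt); split=> //; apply/hA.
Qed.

End RootElimination.

(** * Quantifier elimination *)

Section TestPoints.
Variables (K : closedFieldType) (D : vdiv K) (c0 : K).
Hypothesis c0_gt : sdv D 1 c0.
Hypothesis c0_neq0 : c0 != 0.

Definition shifts := [:: 1; c0; c0^-1].

(* [u'] is the midpoint of the elements of [S] next to [u] on either side or,
   if there is none on one side, lies beyond the last element of [S]. *)
Lemma test_radius (S : seq K) (u : K) : u != 0 -> 1 \in S -> 0 \notin S ->
  exists k, exists w1, exists w2, [/\ k \in shifts, w1 \in S, w2 \in S &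
    forall u', u' ^+ 2 = k * (w1 * w2) ->
      forall w, w \in S -> D w u = D w u' /\ D u w = D u' w].
Proof.
move=> u0 S1 S0.
have hasS : has predT S by apply/hasP; exists 1.
have nz w : w \in S -> w != 0 by apply: contraTneq => ->.
(* If v(u) < v(w) on all of [S], the factor [c0^-1] puts [u'] below the least element. *)
have [hl|nl] := boolP (has (fun w => D w u) S); last first.
  have [l /andP[lS _] hl] := dv_seq_min D hasS.
  have lu w : w \in S -> ~~ D w u by move=> wS; apply: contra nl => h; apply/hasP; exists w.
  exists c0^-1, l, l; split=> // [|u' e w wS]; first by rewrite !inE eqxx !orbT.
  have u'l : sdv D u' l.
    rewrite /sdv -(dvXE D 1) e -expr2; apply: contraL c0_gt => h.
    have n0 := mulf_neq0 (invr_neq0 c0_neq0) (expf_neq0 2 (nz _ lS)).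
    rewrite /sdv negbK -(dv_mul2r D _ _ n0).
    by rewrite mulrA divff // !mul1r.
  have u'w := sdv_dv_trans u'l (hl w wS isT).
  rewrite (sdvW u'w); move: (u'w); rewrite /sdv => /negPf ->.
  by rewrite (negPf (lu w wS)) (sdvW (lu w wS)).
(* If v(u) > v(w) on all of [S], the factor [c0] puts [u'] above the greatest element. *)
have [hm|nm] := boolP (has (fun w => D u w) S); last first.
  have [m /andP[mS _] hm] := dv_seq_max D hasS.
  have um w : w \in S -> ~~ D u w by move=> wS; apply: contra nm => h; apply/hasP; exists w.
  exists c0, m, m; split=> // [|u' e w wS]; first by rewrite !inE eqxx !orbT.
  have mu' : sdv D m u'.
    rewrite /sdv -(dvXE D 1) e -expr2; apply: contraL c0_gt => h.
    rewrite /sdv negbK -(dv_mul2r D _ _ (expf_neq0 2 (nz _ mS))).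
    by rewrite mul1r.
  have wu' := dv_sdv_trans (hm w wS isT) mu'.
  rewrite (sdvW wu'); move: (wu'); rewrite /sdv => /negPf ->.
  by rewrite (negPf (um w wS)) (sdvW (um w wS)).
(* [l] and [m] are the neighbours of [u] in [S], and 2 v(u') = v(l) + v(m). *)
have [l /andP[lS lu] {}hl] := dv_seq_max D hl.
have [m /andP[mS um] {}hm] := dv_seq_min D hm.
have lm := dv_trans lu um.
exists 1, l, m; split=> [|//|//|u']; first by rewrite inE eqxx.
rewrite mul1r => e w wS; split.
  apply/idP/idP => [wu|wu'].
    rewrite -(dvXE D 1) e expr2; have wl := hl w wS wu.
    by rewrite dv_mul // (dv_trans wl).
  apply/negPn/negP => nwu; have mw := hm w wS (sdvW nwu).
  have : D (w ^+ 2) (u' ^+ 2) by rewrite dvXE.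
  rewrite e => h; case/negP: nwu; rewrite -(dvXE D 1); apply: dv_trans h _.
  have ml : D m l.
    rewrite -(dv_mul2r D _ _ (nz _ mS)); apply: dv_trans (_ : D (w ^+ 2) _).
      by rewrite expr2 dv_mul.
    by rewrite -e dvXE.
  by rewrite expr2 dv_mul // (dv_trans ml).
apply/idP/idP => [uw|u'w].
  rewrite -(dvXE D 1) e expr2; have mw := hm w wS uw.
  by rewrite dv_mul // (dv_trans lm).
apply/negPn/negP => nuw; have wl := hl w wS (sdvW nuw).
have : D (u' ^+ 2) (w ^+ 2) by rewrite dvXE.
rewrite e => h; case/negP: nuw; rewrite -(dvXE D 1); apply: (dv_trans _ h).
have ml : D m l.
  rewrite -(dv_mul2l D _ _ (nz _ lS)); apply: dv_trans (_ : D _ (w ^+ 2)) _ => //.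
  by rewrite expr2 dv_mul.
by rewrite expr2 dv_mul // (dv_trans um).
Qed.

Lemma gauss_at_le (p : {poly K}) u x : gauss_at D p u ->
  D p.[u] x <-> x = 0 \/ exists j, D (p`_j * u ^+ j) x.
Proof.
move=> g; split=> [h|[->|[j h]]]; first last.
- by have /(g _)/(_ j) := dvxx D p.[u] => h'; apply: dv_trans h' h.
- exact: dvx0.
have [->|x0] := eqVneq x 0; [by left | right; apply: NNPP => ne].
have : sdv D x p.[u]; last by rewrite /sdv h.
rewrite horner_coef; apply: sdv_sum => // i _.
by apply/negP => hi; apply: ne; exists i.
Qed.

Lemma gauss_at_cmp (p q : {poly K}) u u' : u != 0 -> u' != 0 ->
  gauss_at D p u -> gauss_at D q u -> gauss_at D p u' -> gauss_at D q u' ->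
  (forall i j, D (p`_i * u ^+ i) (q`_j * u ^+ j) = D (p`_i * u' ^+ i) (q`_j * u' ^+ j)) ->
  D p.[u] q.[u] = D p.[u'] q.[u'].
Proof.
move=> u0 u'0 gp gq gp' gq' h.
have e j : D p.[u] (q`_j * u ^+ j) <-> D p.[u'] (q`_j * u' ^+ j).
  rewrite (gauss_at_le _ gp) (gauss_at_le _ gp').
  have z (v : K) : v != 0 -> q`_j * v ^+ j = 0 <-> q`_j = 0.
    by move=> v0; split=> [/eqP|->]; rewrite ?mul0r // mulf_eq0 expf_eq0 (negPf v0)
      andbF orbF => /eqP.
  rewrite !z //; split=> -[?|[i hi]]; by [left | right; exists i; rewrite ?h // -h].
by apply/idP/idP => [/(gq _)|/(gq' _)] hq; [apply/(gq' _)|apply/(gq _)] => j; apply/e.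
Qed.

Variables (E : Type) (P : fring K E).

(** Any [t] in the fibre can be replaced by a test point with the same comparisons between finitely
    many polynomials. Test points arise by extracting roots, so the quantifier falls to
    [qf_ex_root]. *)
Lemma qf_exists (S : E * K -> Prop) : qf D (ext P) S ->
  qf D P (fun y => exists t, S (y, t)).
Proof.
move=> hS; have [I0 [f0 [Pf0 hf0]]] := qf_finite hS.
have /fin_all_exists2[p0 Pp0 ep0] : forall i : I0, exists2 p, polyc P p &
  forall e, f0 i e = (p e.1).[e.2] by [].
(* X is added to the family so that 0 is among the roots and a nearest root exists. *)
pose I : finType := option I0; pose p (i : I) := if i is Some j then p0 j else fun=> 'X.
have Pp i : polyc P (p i) by case: i => [i|]; [apply: Pp0 | apply: polycX].
have hp y t t' : (forall i j, D (p i y).[t] (p j y).[t] = D (p i y).[t'] (p j y).[t']) ->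
    S (y, t) -> S (y, t').
  move=> h; rewrite (hf0 (y, t) (y, t')) // => i j.
  by rewrite !ep0; apply: (h (Some i) (Some j)).
(* [q i (y, r)] is the expansion of [p i y] at [r]. *)
have /fin_all_exists2[q Pq eq] : forall i : I, exists2 q, polyc (ext P) q &
    forall y r x, (q (y, r)).[x] = (p i y).[r + x].
  move=> i; have [q Pq eq] : ext (ext P) (fun e : E * K * K => (p i e.1.1).[e.1.2 + e.2]).
    apply: fr_horner.
      by apply: (polyc_comp (pi := fun e : E * K * K => e.1.1) _ (Pp i)) => f Pf;
        apply: ext_fst (ext_fst Pf).
    by apply: fr_add; [apply: ext_fst (ext_snd _) | apply: ext_snd].
  by exists q => // y r x; rewrite (eq (y, r, x)).
have /fin_all_exists[N' hN'] : forall i : I, exists n, forall e, (size (q i e) <= n)%N.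
  by move=> i; case: (Pq i).
pose N := (\sum_i N' i)%N.
have hN i e : (size (q i e) <= N)%N.
  by apply: leq_trans (hN' i e) _; rewrite /N (bigD1 i) //= leq_addr.
pose Idx : finType := (I * 'I_N)%type.
(* If [m1] has the smaller exponent, at a root of [BP (Some (m1, m2)) e] the two monomials have the
   same value. X - 1 supplies the radius of 1, so that the list of radii is not empty. *)
pose BP (b : option (Idx * Idx)) (e : E * K) : {poly K} :=
  if b is Some (m1, m2) then
    ((q m2.1 e)`_(m2.2))%:P * 'X^(m2.2 - m1.2) + (- (q m1.1 e)`_(m1.2))%:P
  else 'X + (- 1)%:P.
have PBP b : polyc (ext P) (BP b).
  case: b => [[m1 m2]|]; last exact: polycD (polycX _) (polycC (fr_cst _ _)).
  have hq (m : Idx) := (Pq m.1).2 (m.2 : nat).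
  apply: polycD; last by apply: polycC; apply: fr_opp (hq m1).
  by apply: polycM (polycXn _ _); apply: polycC (hq m2).
have [Z hZ sZ] := unit_seq_exists D (#|I| * N).+1.
(* The projection is the union over the test points t = r + z * u, where r is a
   root of some p i, u ^+ 2 = k * w1 * w2 with k in [shifts], and w1, w2 are radii
   at which two monomials of the expansions at r have the same value. *)
pose B3 (e : E * K * K * K * K) := exists z : 'I_(size Z),
  S (e.1.1.1.1, e.1.1.1.2 + Z`_z * e.2).
pose Q (k : 'I_3) (e : E * K * K * K) : {poly K} :=
  'X^2 + (- (shifts`_k * (e.1.2 * e.2)))%:P.
pose B2 (e : E * K * K * K) := exists k, Q k e != 0 /\
  exists2 u, root (Q k e) u & B3 (e, u).
pose B1 (e : E * K * K) := exists b, BP b e.1 != 0 /\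
  exists2 w, root (BP b e.1) w & B2 (e, w).
pose B (e : E * K) := S e \/ exists b, BP b e != 0 /\
  exists2 w, root (BP b e) w & B1 (e, w).
(* One root elimination for each of w1, w2 and u; the one for r follows below. *)
have qB : qf D (ext P) B.
  apply: qf_or => //; apply: qf_ex => b; apply: qf_ex_root (PBP b) _.
  apply: qf_ex => b'; apply: qf_ex_root.
    by apply: polyc_comp (PBP b') => f; apply: ext_fst.
  apply: qf_ex => k; apply: qf_ex_root.
    apply: polycD (polycXn _ _) (polycC (fr_opp _)); apply: fr_mul (fr_cst _ _) _.
    by apply: fr_mul; [apply: ext_fst (ext_snd _) | apply: ext_snd].
  apply: qf_ex => z; apply: (qf_comp _ hS) => f.
  apply: (ext_comp (pi := fun e : E * K * K * K * K => e.1.1.1.1)) => [g Pg|].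
    exact: ext_fst (ext_fst (ext_fst (ext_fst Pg))).
  apply: fr_add; first exact: ext_fst (ext_fst (ext_fst (ext_snd P))).
  by apply: fr_mul (fr_cst _ _) (ext_snd _).
apply: qf_iff (qf_ex (fun i => qf_ex_root (Pp i) qB)) => y; split.
  move=> [i [_ [r _ [Sr|]]]]; first by exists r.
  by move=> [b [_ [w _ [b' [_ [w' _ [k [_ [u _ [z h]]]]]]]]]]; eexists; apply: h.
move=> [t St].
pose rts := flatten [seq roots_of (p i y) | i <- enum I].
have mem_rts i x : p i y != 0 -> root (p i y) x -> x \in rts.
  move=> pi0 rx; apply/flattenP; exists (roots_of (p i y)).
    by apply/map_f; rewrite mem_enum.
  by rewrite mem_roots_of.
have hs : has predT [seq t - r | r <- rts].
  apply/hasP; exists (t - 0) => //; apply/map_f/(@mem_rts None); first by rewrite polyX_eq0.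
  by rewrite /root hornerX.
(* [r] is a root nearest to [t]. *)
have [_ /andP[/mapP[r r_rts ->] _] near_r] := dv_seq_max D hs.
have {}near_r x : x \in rts -> D (t - x) (t - r).
  by move=> xr; apply: near_r => //; apply: map_f.
have [i pi0 root_r] : exists2 i, p i y != 0 & root (p i y) r.
  case/flattenP: r_rts => _ /mapP[i _ ->]; have [->|pi0] := eqVneq (p i y) 0.
    by rewrite /roots_of eqxx.
  by rewrite mem_roots_of //; exists i.
exists i; split=> //; exists r => //.
have [tr|tr] := eqVneq t r; [by left; rewrite -tr | right].
pose u := t - r; have u0 : u != 0 by rewrite subr_eq0.
pose e := (y, r).
pose W := [seq w <- flatten [seq roots_of (BP b e) | b <- enum {: option (Idx * Idx)}]
  | w != 0].
have memW b w : BP b e != 0 -> root (BP b e) w -> w != 0 -> w \in W.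
  move=> b0 rw w0; rewrite mem_filter w0; apply/flattenP; exists (roots_of (BP b e)).
    by apply/map_f; rewrite mem_enum.
  by rewrite mem_roots_of.
have inW w : w \in W -> exists2 b, BP b e != 0 & root (BP b e) w.
  rewrite mem_filter => /andP[_ /flattenP[_ /mapP[b _ ->]]].
  have [->|b0] := eqVneq (BP b e) 0; first by rewrite /roots_of eqxx.
  by rewrite mem_roots_of //; exists b.
have W1 : 1 \in W.
  apply: (memW None); rewrite ?oner_neq0 // /BP.
    by rewrite polyCN polyC1 -polyC1 polyXsubC_eq0.
  by rewrite /root !hornerE subrr.
have W0 : 0 \notin W by rewrite mem_filter eqxx.
have [k [w1 [w2 [hk w1W w2W hw]]]] := test_radius u0 W1 W0.
have [u' eu'] := nth_root_exists 1 (k * (w1 * w2)).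
have {}hw := hw u' eu'.
have nzW w : w \in W -> w != 0 by rewrite mem_filter => /andP[].
have u'0 : u' != 0.
  have k0 : k != 0.
    by move: hk; rewrite !inE => /or3P[] /eqP ->; rewrite ?oner_neq0 ?invr_neq0.
  have : u' ^+ 2 != 0 by rewrite eu' (mulf_neq0 k0) // mulf_neq0 // nzW.
  by rewrite expf_eq0.
have bp i1 i2 j1 j2 : (q i1 e)`_j1 != 0 -> (q i2 e)`_j2 != 0 -> (j1 < j2)%N ->
    exists2 w, w \in W & (q i1 e)`_j1 = (q i2 e)`_j2 * w ^+ (j2 - j1).
  move=> n1 n2 lt.
  have ltN i' j : (q i' e)`_j != 0 -> (j < N)%N.
    by apply: contraNltn => h; rewrite nth_default // (leq_trans (hN i' e)).
  have [w ew] := nth_root_exists (j2 - j1).-1 ((q i1 e)`_j1 / (q i2 e)`_j2).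
  rewrite prednK ?subn_gt0 // in ew.
  exists w; last by rewrite ew mulrC divfK.
  have w0 : w != 0.
    apply: contraNneq n1 => w0; move: ew; rewrite w0 expr0n subn_eq0 leqNgt lt /=.
    by move/eqP; rewrite eq_sym mulf_eq0 invr_eq0 (negPf n2) orbF.
  apply: (memW (Some ((i1, Ordinal (ltN _ _ n1)), (i2, Ordinal (ltN _ _ n2))))) => //=.
    apply: contraNneq n1 => /(congr1 (fun g : {poly K} => g`_0)).
    rewrite coefD coefMXn subn_gt0 lt coefC eqxx coef0 add0r => /eqP.
    by rewrite oppr_eq0.
  by rewrite /root !hornerE ew mulrC divfK // subrr.
(* As [u] and [u'] compare in the same way with every radius in [W], they order any two monomials
   alike. *)
have mono i1 i2 j1 j2 :
    D ((q i1 e)`_j1 * u ^+ j1) ((q i2 e)`_j2 * u ^+ j2) =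
    D ((q i1 e)`_j1 * u' ^+ j1) ((q i2 e)`_j2 * u' ^+ j2).
  have D0 x : D 0 x = (x == 0) by apply/idP/eqP => [/dv0x|->]; rewrite ?dvxx.
  have [->|n1] := eqVneq (q i1 e)`_j1 0.
    by rewrite !mul0r !D0 !mulf_eq0 !expf_eq0 (negPf u0) (negPf u'0).
  have [->|n2] := eqVneq (q i2 e)`_j2 0; first by rewrite !mul0r !dvx0.
  case: (ltngtP j1 j2) => h; last first.
  - by rewrite h !dv_mul2r ?expf_neq0.
  - have [w wW ew] := bp _ _ _ _ n2 n1 h; rewrite ew -[in u ^+ j1](subnK (ltnW h)).
    rewrite -[in u' ^+ j1](subnK (ltnW h)) !exprD !mulrA !(dv_mul2r D _ _ (expf_neq0 _ _)) //.
    rewrite !(dv_mul2l D) // -[(j1 - j2)%N]prednK ?subn_gt0 // !dvXE.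
    by case: (hw w wW).
  have [w wW ew] := bp _ _ _ _ n1 n2 h; rewrite ew -[in u ^+ j2](subnK (ltnW h)).
  rewrite -[in u' ^+ j2](subnK (ltnW h)) !exprD !mulrA !(dv_mul2r D _ _ (expf_neq0 _ _)) //.
  rewrite !(dv_mul2l D) // -[(j2 - j1)%N]prednK ?subn_gt0 // !dvXE.
  by case: (hw w wW).
have [|z zZ hz] := @generic_unit _ D Z (flatten [seq roots_of (q i e) | i <- enum I]) u' hZ u'0.
  rewrite sZ ltnS cardE; elim: (enum I) => //= a s IH.
  rewrite size_cat mulSn leq_add // size_roots_of (leq_trans (leq_pred _)) //.
have St' : S (y, r + z * u').
  apply: hp St => i1 i2.
  have zu'0 : z * u' != 0.
    rewrite mulf_neq0 //; case: hZ => _ /(_ z zZ)/eqdv_eq0 -> _; exact: oner_neq0.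
  have -> : t = r + u by rewrite /u addrC subrK.
  have gz i' : gauss_at D (q i' e) (z * u').
    apply: gauss_at_generic => // s sq; apply: hz.
    by apply/flattenP; exists (roots_of (q i' e)) => //; apply/map_f; rewrite mem_enum.
  (* A root s of an expansion gives a root r + s of some [p i], which is no nearer to [t] than [r];
     so [u] is generic for the expansions. *)
  have gu i' : gauss_at D (q i' e) u.
    have [->|qi0] := eqVneq (q i' e) 0; first exact: gauss_at0.
    apply: gauss_at_generic => // s; rewrite mem_roots_of // => /rootP sq.
    have -> : u - s = t - (r + s) by rewrite /u opprD addrA.
    apply: near_r; apply: (mem_rts i'); last by rewrite /root -eq -/e sq.
    apply: contraNneq qi0 => pi'0; apply/eqP/(poly_ext_eq0 D) => x.
    by rewrite eq pi'0 horner0.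
  rewrite -!eq -/e; apply: gauss_at_cmp => // j1 j2; rewrite mono.
  have ez j (x : K) : eqdv D (x * (z * u') ^+ j) (x * u' ^+ j).
    apply: eqdv_mul (eqdv_refl _ _) _; apply: eqdvX.
    rewrite -[X in eqdv _ _ X]mul1r; apply: eqdv_mul (eqdv_refl _ _).
    by case: hZ => _ /(_ z zZ).
  by rewrite (eqdv_dvl _ (ez _ _)) (eqdv_dvr _ (ez _ _)).
have [b1 nb1 rb1] := inW _ w1W; have [b2 nb2 rb2] := inW _ w2W.
exists b1; split=> //; exists w1 => //; exists b2; split=> //; exists w2 => //.
move: hk => /(nthP 0)[k' ltk ek]; exists (Ordinal ltk).
have -> : Q (Ordinal ltk) (e, w1, w2) = 'X^2 + (- (k * (w1 * w2)))%:P.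
  by rewrite /Q /= ek.
split; first by rewrite -size_poly_eq0 size_polyDl size_polyXn // size_polyC; case: eqP.
exists u'; first by rewrite /root hornerD hornerXn hornerC eu' subrr.
case/(nthP 0): zZ => z' ltz ez; exists (Ordinal ltz).
by rewrite /= ez.
Qed.

End TestPoints.

(** * Definability with parameters *)

Section Pdef.
Variables (S : language) (M : structure S).

(* The parameters [c] and the variables of [A] may be placed at arbitrary
   positions [f] and [ix] among the variables of a formula, which makes
   renaming of variables unnecessary. *)
Definition pdef n (A : n.-tuple M -> Prop) :=
  exists (I : finType) (c : I -> M), forall N (f : I -> 'I_N) (ix : 'I_n -> 'I_N),
  exists delta : formula S N, forall e : N.-tuple M, (forall i, tnth e (f i) = c i) ->
    (sat delta e <-> A [tuple tnth e (ix i) | i < n]).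

Definition pterm n (h : n.-tuple M -> M) :=
  exists (I : finType) (c : I -> M), forall N (f : I -> 'I_N) (ix : 'I_n -> 'I_N),
  exists t : term S N, forall e : N.-tuple M, (forall i, tnth e (f i) = c i) ->
    teval e t = h [tuple tnth e (ix i) | i < n].

Lemma pterm_eq n (g h : n.-tuple M -> M) : (forall e, g e = h e) -> pterm g -> pterm h.
Proof.
move=> e [I [c H]]; exists I, c => N f ix; have [t ht] := H N f ix.
by exists t => u hu; rewrite -e ht.
Qed.

Lemma pterm_cst n (a : M) : pterm (fun _ : n.-tuple M => a).
Proof. by exists unit, (fun=> a) => N f ix; exists (Var S (f tt)) => e; apply. Qed.

Lemma pterm_proj n i : pterm (fun e : n.-tuple M => tnth e i).
Proof.
exists void, (fun x : void => match x with end) => N f ix.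
by exists (Var S (ix i)) => e _; rewrite tnth_mktuple.
Qed.

Lemma pterm_app n (s : fsym S) (h : 'I_(farity s) -> n.-tuple M -> M) :
  (forall i, pterm (h i)) -> pterm (fun e => fun_interp [tuple h i e | i < farity s]).
Proof.
move=> /fin_all_exists[I /fin_all_exists[c H]].
exists {i : 'I_(farity s) & I i}, (fun x => c (tag x) (tagged x)) => N f ix.
have /fin_all_exists[t ht] := fun i => H i N (fun x => f (Tagged I x)) ix.
exists (App t) => e he /=; congr (fun_interp _); apply: eq_from_tnth => i.
by rewrite !tnth_mktuple ht // => x; rewrite he.
Qed.

Lemma pdef_rel n (s : rsym S) (h : 'I_(rarity s) -> n.-tuple M -> M) :
  (forall i, pterm (h i)) -> pdef (fun e => rel_interp [tuple h i e | i < rarity s]).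
Proof.
move=> /fin_all_exists[I /fin_all_exists[c H]].
exists {i : 'I_(rarity s) & I i}, (fun x => c (tag x) (tagged x)) => N f ix.
have /fin_all_exists[t ht] := fun i => H i N (fun x => f (Tagged I x)) ix.
exists (Rel t) => e he /=; have -> // : [tuple teval e (t i) | i < rarity s] =
  [tuple h i [tuple tnth e (ix j) | j < n] | i < rarity s].
by apply: eq_from_tnth => i; rewrite !tnth_mktuple ht // => x; rewrite he.
Qed.

Lemma pdef_iff n (A B : n.-tuple M -> Prop) : (forall e, A e <-> B e) -> pdef A -> pdef B.
Proof.
move=> e [I [c H]]; exists I, c => N f ix; have [t ht] := H N f ix.
by exists t => u hu; rewrite -e ht.
Qed.

Lemma pdef_imp n (A B : n.-tuple M -> Prop) : pdef A -> pdef B ->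
  pdef (fun e => A e -> B e).
Proof.
move=> [I [c H]] [J [d H']].
exists (I + J)%type, (fun k => match k with inl i => c i | inr j => d j end) => N f ix.
have [a ha] := H N (fun i => f (inl i)) ix; have [b hb] := H' N (fun j => f (inr j)) ix.
exists (Imp a b) => e he /=.
by rewrite (ha e (fun i => he (inl i))) (hb e (fun j => he (inr j))).
Qed.

Lemma pdef_false n : pdef (fun _ : n.-tuple M => False).
Proof.
exists void, (fun x : void => match x with end) => N f ix.
by exists (Bot S N).
Qed.

Lemma pdef_not n (A : n.-tuple M -> Prop) : pdef A -> pdef (fun e => ~ A e).
Proof. by move=> hA; apply: pdef_imp hA (pdef_false n). Qed.

Lemma pdef_and n (A B : n.-tuple M -> Prop) : pdef A -> pdef B ->
  pdef (fun e => A e /\ B e).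
Proof.
move=> hA hB; apply: pdef_iff (pdef_not (pdef_imp hA (pdef_not hB))) => e.
by case: (classic (A e)); case: (classic (B e)); tauto.
Qed.

Lemma pdef_or n (A B : n.-tuple M -> Prop) : pdef A -> pdef B ->
  pdef (fun e => A e \/ B e).
Proof.
move=> hA hB; apply: pdef_iff (pdef_imp (pdef_not hA) hB) => e.
by case: (classic (A e)); tauto.
Qed.

Lemma pdef_cst n (Q : Prop) : pdef (fun _ : n.-tuple M => Q).
Proof.
case: (classic Q) => h; last by apply: pdef_iff (pdef_false n).
by apply: pdef_iff (pdef_not (pdef_false n)) => e; tauto.
Qed.

Lemma pdef_ex_seq n (I : Type) (s : seq I) (A : I -> n.-tuple M -> Prop) :
  (forall i, pdef (A i)) -> pdef (fun e => List.Exists (A^~ e) s).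
Proof.
move=> h; elim: s => [|i s IH].
  by apply: pdef_iff (pdef_false n) => e; split=> // /List.Exists_nil.
by apply: pdef_iff (pdef_or (h i) IH) => e; rewrite List.Exists_cons.
Qed.

Lemma pdef_all_seq n (I : Type) (s : seq I) (A : I -> n.-tuple M -> Prop) :
  (forall i, pdef (A i)) -> pdef (fun e => List.Forall (A^~ e) s).
Proof.
move=> h; elim: s => [|i s IH].
  by apply: pdef_iff (pdef_cst n True) => e; split.
by apply: pdef_iff (pdef_and (h i) IH) => e; rewrite List.Forall_cons_iff.
Qed.

Lemma pdef_definable m (A : m.-tuple M -> Prop) : pdef A ->
  exists k (delta : formula S (m + k)) (c : k.-tuple M),
    forall b : m.-tuple M, A b <-> sat delta [tuple of b ++ c].
Proof.
move=> [I [c H]]; exists #|I|.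
have [d hd] := H (m + #|I|)%N (fun i => rshift m (enum_rank i)) (fun i => lshift #|I| i).
exists d, [tuple c (enum_val i) | i < #|I|] => b; rewrite hd.
  suff -> : [tuple tnth [tuple of b ++ [tuple c (enum_val i) | i < #|I|]]
    (lshift #|I| i) | i < m] = b by [].
  by apply: eq_from_tnth => i; rewrite tnth_mktuple tnth_lshift.
by move=> i; rewrite tnth_rshift tnth_mktuple enum_rankK.
Qed.

End Pdef.

(** * Polynomial functions on tuples *)

Section Polyfun.
Variable K : fieldType.

Inductive polyfun_pred n : (n.-tuple K -> K) -> Prop :=
| polyfun_ext f g : (forall e, f e = g e) -> polyfun_pred f -> polyfun_pred g
| polyfun_cst c : polyfun_pred (fun=> c)
| polyfun_proj i : polyfun_pred (fun e => tnth e i)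
| polyfun_add f g : polyfun_pred f -> polyfun_pred g -> polyfun_pred (fun e => f e + g e)
| polyfun_mul f g : polyfun_pred f -> polyfun_pred g -> polyfun_pred (fun e => f e * g e).

Definition polyfun n : fring K (n.-tuple K) :=
  Fring (@polyfun_ext n) (@polyfun_cst n) (@polyfun_add n) (@polyfun_mul n).

Lemma fr_proj n (i : 'I_n) : polyfun n (fun e => tnth e i).
Proof. exact: polyfun_proj. Qed.

Lemma polyfun_comp n E (P : fring K E) (h : E -> n.-tuple K) f :
  (forall i, P (fun e => tnth (h e) i)) -> polyfun n f -> P (fun e => f (h e)).
Proof.
move=> hh; elim=> {f} [f g e _ IH|c|i|f g _ IHf _ IHg|f g _ IHf _ IHg].
- by apply: fr_ext IH => x.
- exact: fr_cst.
- exact: hh.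
- exact: fr_add.
- exact: fr_mul.
Qed.

Lemma tnth_consE T n (x : T) (e : n.-tuple T) (i : 'I_n.+1) :
  tnth [tuple of x :: e] i = if unlift ord0 i is Some j then tnth e j else x.
Proof.
case: unliftP => [j ->|->]; last by rewrite tnth0.
by rewrite tnthS.
Qed.

(** The first variable, the one bound by [All], becomes the variable t of [ext]. *)
Lemma polyfun_cons n f : polyfun n.+1 f ->
  ext (polyfun n) (fun e => f [tuple of e.2 :: e.1]).
Proof.
apply: polyfun_comp => i.
case: (unliftP ord0 i) => [j ->|->].
  by apply: fr_ext (ext_fst (P := polyfun n) (polyfun_proj j)) => e; rewrite tnthS.
by apply: fr_ext (ext_snd _) => e; rewrite tnth0.
Qed.

End Polyfun.

(** * The divisibility relation of a valuation *)

Section OrderedGroup.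
Variable G : orderedGroupType.
Implicit Types x y z : G.

Lemma og_ltNge x y : (x < y) = ~~ (y <= x).
Proof.
rewrite lt_neqAle; apply/andP/idP => [[ne xy]|nyx].
  by apply: contra ne => yx; apply/eqP/le_anti; rewrite xy yx.
split; first by apply: contraNneq nyx => ->.
by case/orP: (le_total_og x y) => // h; rewrite h in nyx.
Qed.

Lemma og_leD2r z x y : (x + z <= y + z) = (x <= y).
Proof.
apply/idP/idP => [h|h]; last by rewrite ![_ + z]addrC le_add2l_og.
by have := le_add2l_og (- z) _ _ h; rewrite ![- z + _]addrC !addrK.
Qed.

Lemma og_leBB x y x' y' : (x - y <= x' - y') = (x + y' <= x' + y).
Proof.
rewrite -(og_leD2r (y + y')) addrA subrK.
by rewrite -[X in _ <= X]addrA [y + y']addrC addKr.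
Qed.

End OrderedGroup.

Section VdivOf.
Variables (K : fieldType) (G : orderedGroupType) (v : valuation K G).

Lemma vle_trans : transitive (@vle G).
Proof. by move=> [y|] [x|] [z|] //=; apply: le_trans. Qed.

Lemma vle_total : total (@vle G).
Proof. by move=> [x|] [y|] //=; apply: le_total_og. Qed.

Lemma vle_refl : reflexive (@vle G).
Proof. by move=> [x|] //=. Qed.

Lemma vle_vmin (c a b : option G) : vle c (vmin a b) = vle c a && vle c b.
Proof.
rewrite /vmin; case: ifP => h.
  by case ca : (vle c a) => //=; rewrite (vle_trans ca h).
have ba : vle b a by have := vle_total a b; rewrite h.
by case cb : (vle c b); rewrite ?andbF // (vle_trans cb ba).
Qed.

Lemma val0 : v 0 = None. Proof. by apply/(val_infty v). Qed.

Lemma val_neq0 x : x != 0 -> exists g, v x = Some g.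
Proof.
by case e : (v x) => [g|]; [exists g | move/(val_infty v): e => ->; rewrite eqxx].
Qed.

Fact val_dvx0 x : vle (v x) (v 0). Proof. by rewrite val0. Qed.

Fact val_dv0x x : vle (v 0) (v x) -> x = 0.
Proof. by rewrite val0 => h; apply/(val_infty v); case: (v x) h. Qed.

Fact val_dv_mul2r z x y : z != 0 -> vle (v (x * z)) (v (y * z)) = vle (v x) (v y).
Proof.
move=> /val_neq0[g ez]; rewrite !val_mul ez.
by case: (v x) => [a|]; case: (v y) => [b|] //=; rewrite og_leD2r.
Qed.

Fact val_dv_add z x y : vle (v z) (v x) -> vle (v z) (v y) -> vle (v z) (v (x + y)).
Proof.
by move=> zx zy; apply: vle_trans (val_add v x y); rewrite vle_vmin zx.
Qed.

Definition vdiv_of : vdiv K := @Vdiv K (fun x y => vle (v x) (v y))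
  (fun x y => vle_total (v x) (v y)) (fun y x z => @vle_trans (v y) (v x) (v z))
  val_dvx0 val_dv0x val_dv_mul2r val_dv_add.

(** The default 0 is taken at x = 0, whence the conditions [x != 0] below. *)
Definition vgrp (x : K) : G := odflt 0 (v x).

Lemma val_vgrp x : x != 0 -> v x = Some (vgrp x).
Proof. by move=> /val_neq0[g e]; rewrite /vgrp e. Qed.

Lemma vgrpM x y : x != 0 -> y != 0 -> vgrp (x * y) = vgrp x + vgrp y.
Proof. by move=> x0 y0; rewrite /vgrp val_mul !val_vgrp. Qed.

Lemma dv_vgrp x y : x != 0 -> y != 0 -> vdiv_of x y = (vgrp x <= vgrp y).
Proof. by move=> x0 y0; rewrite /= !val_vgrp. Qed.

Lemma vgrp_surj g : exists2 x, x != 0 & vgrp x = g.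
Proof.
have [x e] := val_surj v g; exists x; last by rewrite /vgrp e.
by apply/eqP => /(val_infty v); rewrite e.
Qed.

Lemma vgrp1 : vgrp 1 = 0.
Proof.
have := vgrpM (oner_neq0 K) (oner_neq0 K); rewrite mulr1 => /eqP.
by rewrite eq_sym -subr_eq0 addrK => /eqP.
Qed.

(** One of x and its inverse has positive value. *)
Lemma nontrivial_gt : nontrivial v -> exists2 c, c != 0 & sdv vdiv_of 1 c.
Proof.
move=> [x [/eqP x0 vx]]; have g0 : vgrp x != 0.
  by apply/eqP => e; apply: vx; rewrite val_vgrp // e.
have [h|h] := boolP (sdv vdiv_of 1 x); first by exists x.
exists x^-1; first by rewrite invr_eq0.
rewrite /sdv -(dv_mul2r vdiv_of _ _ x0) mulVf // mul1r; apply: contra g0 => h'.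
rewrite /sdv negbK in h; rewrite !dv_vgrp ?oner_neq0 // vgrp1 in h h'.
by apply/eqP/le_anti; rewrite h h'.
Qed.

Lemma pterm_polyfun n f : polyfun K n f -> @pterm vf_language (vf_structure v) n f.
Proof.
elim=> {f} [f g e _ IH|c|i|f g _ IHf _ IHg|f g _ IHf _ IHg].
- exact: pterm_eq IH.
- exact: pterm_cst.
- exact: pterm_proj.
- pose h (i : 'I_2) := if i == ord0 then f else g.
  have := @pterm_app vf_language (vf_structure v) n VfAdd h.
  move=> /(_ _)H; apply: pterm_eq (H _) => [e|i].
    by rewrite /= !tnth_mktuple.
  by rewrite /h; case: ifP.
- pose h (i : 'I_2) := if i == ord0 then f else g.
  have := @pterm_app vf_language (vf_structure v) n VfMul h.
  move=> /(_ _)H; apply: pterm_eq (H _) => [e|i].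
    by rewrite /= !tnth_mktuple.
  by rewrite /h; case: ifP.
Qed.

Lemma pdef_qf n A : qf vdiv_of (polyfun K n) A -> @pdef vf_language (vf_structure v) n A.
Proof.
elim=> {A} [p q Pp Pq|A _ IH|A B _ IHA _ IHB|A B e _ IH].
- pose h (i : 'I_2) := if i == ord0 then p else q.
  have H := @pdef_rel vf_language (vf_structure v) n VfDiv h.
  apply: pdef_iff (H _) => [e|i]; first by rewrite /= !tnth_mktuple.
  by rewrite /h; case: ifP => _; apply: pterm_polyfun.
- exact: pdef_not.
- exact: pdef_and.
- exact: pdef_iff IH.
Qed.

End VdivOf.

(** * Formulas of valued fields and of value groups *)

Section SatQf.
Variables (K : closedFieldType) (G : orderedGroupType) (v : valuation K G).
Hypothesis nt : nontrivial v.
Let D := vdiv_of v.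

Lemma polyfun_teval n (t : term vf_language n) :
  polyfun K n (fun e => @teval vf_language (vf_structure v) n e t).
Proof.
elim: t => [i|f ts IH]; first exact: polyfun_proj.
case: f ts IH => ts IH /=.
- exact: (fr_cst (polyfun K n)).
- exact: (fr_cst (polyfun K n)).
- by apply: fr_ext (fr_add (IH ord0) (IH ord_max)) => e; rewrite !tnth_mktuple.
- by apply: fr_ext (fr_opp (IH ord0)) => e; rewrite !tnth_mktuple.
- by apply: fr_ext (fr_mul (IH ord0) (IH ord_max)) => e; rewrite !tnth_mktuple.
Qed.

Lemma qf_ex_cons n (A : n.+1.-tuple K -> Prop) : qf D (polyfun K n.+1) A ->
  qf D (polyfun K n) (fun e => exists x, A [tuple of x :: e]).
Proof.
move=> hA; have [c c0 c1] := nontrivial_gt nt.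
apply: (@qf_exists K D c c1 c0 _ (polyfun K n) (fun e => A [tuple of e.2 :: e.1])).
exact: qf_comp (@polyfun_cons K n) hA.
Qed.

Lemma qf_all_cons n (A : n.+1.-tuple K -> Prop) : qf D (polyfun K n.+1) A ->
  qf D (polyfun K n) (fun e => forall x, A [tuple of x :: e]).
Proof.
move=> /qf_not/qf_ex_cons/qf_not; apply: qf_iff => e.
split=> [ne x|h [x]]; last by apply.
by apply: NNPP => nA; apply: ne; exists x.
Qed.

(** Quantifier elimination: [All] is the complement of the projection of a complement. *)
Lemma qf_sat n (phi : formula vf_language n) :
  qf D (polyfun K n) (@sat vf_language (vf_structure v) n phi).
Proof.
elim: phi => {n} [n|n t u|n r ts|n a IHa b IHb|n a IH] /=.
- exact: qf_cst.
- have := qf_eq0 D (fr_sub (polyfun_teval t) (polyfun_teval u)); apply: qf_iff => e.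
  by split=> [/eqP|->]; rewrite ?subrr // subr_eq0 => /eqP.
- case: r ts => ts /=.
  have := qf_dv D (polyfun_teval (ts ord0)) (polyfun_teval (ts ord_max)).
  by apply: qf_iff => e; rewrite !tnth_mktuple.
- exact: qf_imp.
- exact: qf_all_cons.
Qed.

Let w := vgrp v.

(** A term in values is the value of a quotient, kept as a pair since inverses are not
    polynomial. *)
Lemma og_teval n (t : term og_language n) :
  exists2 p, polyfun K n p & exists2 q, polyfun K n q &
    forall e : n.-tuple K, (forall i, tnth e i != 0) -> [/\ p e != 0, q e != 0 &
      @teval og_language (og_structure G) n (map_tuple w e) t = w (p e) - w (q e)].
Proof.
have w1 : w 1 = 0 by apply: vgrp1.
elim: t => [i|f ts IH].
  exists (fun e => tnth e i); first exact: polyfun_proj.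
  exists (fun=> 1); first exact: (fr_cst (polyfun K n)).
  by move=> e he; rewrite oner_neq0 he /= tnth_map w1 subr0.
case: f ts IH => ts IH.
- exists (fun=> 1); first exact: (fr_cst (polyfun K n)).
  exists (fun=> 1); first exact: (fr_cst (polyfun K n)).
  by move=> e he; rewrite oner_neq0 subrr.
- have [p1 Pp1 [q1 Pq1 h1]] := IH ord0; have [p2 Pp2 [q2 Pq2 h2]] := IH ord_max.
  exists (fun e => p1 e * p2 e); first exact: (fr_mul (f := p1)).
  exists (fun e => q1 e * q2 e); first exact: (fr_mul (f := q1)).
  move=> e he; have [a1 b1 e1] := h1 e he; have [a2 b2 e2] := h2 e he.
  rewrite !mulf_neq0 // /= !tnth_mktuple e1 e2 /w !vgrpM //; split=> //.
  by rewrite opprD addrACA.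
- have [p1 Pp1 [q1 Pq1 h1]] := IH ord0; exists q1 => //; exists p1 => //.
  move=> e he; have [a1 b1 e1] := h1 e he.
  by rewrite a1 b1 /= !tnth_mktuple e1 opprB.
Qed.

(** The value group is interpreted in the field: its elements are represented by nonzero field
    elements, over which the quantifiers then range. *)
Lemma qf_og_sat n (phi : formula og_language n) :
  qf D (polyfun K n) (fun e => (forall i, tnth e i != 0) /\
    @sat og_language (og_structure G) n phi (map_tuple w e)).
Proof.
have nz m : qf D (polyfun K m) (fun e => forall i, tnth e i != 0).
  by apply: qf_all => i; apply: qf_neq0; apply: polyfun_proj.
elim: phi => {n} [n|n t u|n r ts|n a IHa b IHb|n a IH] /=.
- exact: qf_and (qf_cst _ _ _).
- have [p1 Pp1 [q1 Pq1 h1]] := og_teval t; have [p2 Pp2 [q2 Pq2 h2]] := og_teval u.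
  have d1 := fr_mul Pp1 Pq2; have d2 := fr_mul Pp2 Pq1.
  have := qf_and (nz n) (qf_and (qf_dv D d1 d2) (qf_dv D d2 d1)); apply: qf_iff => e.
  split=> -[he h]; split=> //; have [a1 b1 e1] := h1 e he; have [a2 b2 e2] := h2 e he;
    move: h; rewrite e1 e2 !dv_vgrp ?mulf_neq0 // !vgrpM //.
    by case=> h h'; apply/le_anti; rewrite !og_leBB h h'.
  by rewrite /w => h; split; rewrite -og_leBB h lexx.
- case: r ts => ts /=.
  have [p1 Pp1 [q1 Pq1 h1]] := og_teval (ts ord0).
  have [p2 Pp2 [q2 Pq2 h2]] := og_teval (ts ord_max).
  have d1 := fr_mul Pp1 Pq2; have d2 := fr_mul Pp2 Pq1.
  have := qf_and (nz n) (qf_sdv D d1 d2); apply: qf_iff => e.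
  have main : (forall i, tnth e i != 0) ->
      sdv D (p1 e * q2 e) (p2 e * q1 e) =
      (@teval og_language (og_structure G) n (map_tuple w e) (ts ord0) <
       @teval og_language (og_structure G) n (map_tuple w e) (ts ord_max) :> G).
    move=> he; have [a1 b1 ->] := h1 e he; have [a2 b2 ->] := h2 e he.
    by rewrite og_ltNge og_leBB /sdv dv_vgrp ?mulf_neq0 // !vgrpM.
  rewrite !tnth_mktuple; split=> -[he]; by rewrite main.
- apply: qf_iff (qf_and (nz n) (qf_imp IHa IHb)) => e; tauto.
- have := qf_and (nz n) (qf_all_cons (qf_imp (nz n.+1) IH)); apply: qf_iff => e.
  have mapE x : map_tuple w [tuple of x :: e] = [tuple of w x :: map_tuple w e].
    exact: val_inj.
  have nzc x : x != 0 -> (forall i, tnth e i != 0) -> forall i, tnth [tuple of x :: e] i != 0.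
    by move=> x0 he i; rewrite tnth_consE; case: unlift.
  split=> -[he h]; split=> //.
    move=> g; have [x x0 <-] := vgrp_surj v g.
    by have [_] := h x (nzc x x0 he); rewrite mapE.
  by move=> x hx; split=> //; rewrite mapE; apply: h.
Qed.

End SatQf.

(** * From separatedness to definability *)

Section VminBig.
Variables (G : orderedGroupType).

Lemma vle_bigvmin n (F : 'I_n -> option G) c :
  vle c (\big[@vmin G/None]_(i < n) F i) = [forall i, vle c (F i)].
Proof.
have all_r (r : seq 'I_n) : vle c (\big[@vmin G/None]_(i <- r) F i) =
    all (fun i => vle c (F i)) r.
  by elim: r => [|i r IH]; rewrite ?big_nil ?big_cons ?vle_vmin ?IH //; case: c.
rewrite all_r; apply/allP/forallP => h i; last by [].
by apply: h; rewrite mem_index_enum.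
Qed.

Lemma bigvmin_vle n (F : 'I_n -> option G) c :
  vle (\big[@vmin G/None]_(i < n) F i) c -> c = None \/ exists i, vle (F i) c.
Proof.
elim/big_rec: _ => [|i x _ IH]; first by case: c => //; left.
by rewrite /vmin; case: ifP => _ h; [right; exists i | apply: IH].
Qed.

End VminBig.

(** * Separated extensions with definable cuts *)

Section Extension.
Variables (K L : closedFieldType) (GK GL : orderedGroupType)
    (vK : valuation K GK) (vL : valuation L GL)
    (iota : {rmorphism K -> L}) (j : {additive GK -> GL})
    (ntK : nontrivial vK) (ntL : nontrivial vL)
    (vext : valued_extension vK vL iota j).
Local Notation DK := (vdiv_of vK).
Local Notation DL := (vdiv_of vL).
Local Notation wK := (vgrp vK).
Local Notation wL := (vgrp vL).

Lemma val_iota x : vL (iota x) = omap j (vK x).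
Proof. by case: vext => _; apply. Qed.

Lemma j_mono a b : (j a <= j b) = (a <= b).
Proof. by case: vext => h _; apply: h. Qed.

Lemma iota_eq0 x : (iota x == 0) = (x == 0). Proof. exact: fmorph_eq0. Qed.

Lemma vgrp_iota x : x != 0 -> wL (iota x) = j (wK x).
Proof. by move=> x0; rewrite /vgrp val_iota (val_vgrp vK x0). Qed.

Lemma dv_iota x y : DL (iota x) (iota y) = DK x y.
Proof.
by rewrite /= !val_iota; case: (vK x) => [a|]; case: (vK y) => [b|] //=; apply: j_mono.
Qed.

Section SeparatedToDefinable.
Hypothesis sep : separated_extension iota vL.
Hypothesis T1 : @T og_language 1 (og_structure GK) (og_structure GL) j.

(** The condition reads v(q b) - v(q' b) <= d for d = v(y') - v(y), so it concerns the cut of d over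
    vK, definable by [T1]; [qf_og_sat] pulls the defining formula back to the field. *)
Lemma qf_cut m (q q' : m.-tuple K -> K) y y' :
  polyfun K m q -> polyfun K m q' ->
  qf DK (polyfun K m) (fun b => DL (iota (q b) * y) (iota (q' b) * y')).
Proof.
move=> Pq Pq'; have [->|y'0] := eqVneq y' 0.
  by apply: qf_iff (qf_true _ _) => b; rewrite mulr0 dvx0.
have [->|y0] := eqVneq y 0.
  apply: qf_iff (qf_eq0 DK Pq') => b; rewrite mulr0; split=> [->|/dv0x/eqP].
    by rewrite rmorph0 mul0r dvxx.
  by rewrite mulf_eq0 (negPf y'0) orbF iota_eq0 => /eqP.
pose x_ i : term og_language (1 + 2) := Var og_language (i : 'I_3).
pose sub12 : term og_language (1 + 2) := @App og_language 3 OgAdd (fun i : 'I_2 =>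
  if i == ord0 then x_ (inord 1) else @App og_language 3 OgOpp (fun _ : 'I_1 => x_ (inord 2))).
(* [phi] is the negation of x_0 < x_1 - x_2, where x_0 stands for [d]. *)
pose phi : formula og_language (1 + 2) := Imp (@Rel og_language 3 OgLt (fun i : 'I_2 =>
  if i == ord0 then x_ ord0 else sub12)) (Bot _ _).
pose d := wL y' - wL y.
have [k [psi [c hc]]] := T1 [tuple d : og_structure GL] phi.
have hcut (g g' : GK) : @sat og_language (og_structure GK) _ psi
    [tuple of [tuple g; g'] ++ c] <-> j g + wL y <= j g' + wL y'.
  rewrite -(hc [tuple g; g']) /tp /= !tnth_mktuple /= !tnth_mktuple /= !tnth_mktuple /=.
  have -> (t : 3.-tuple (og_structure GL)) : tnth t (inord 1) = nth d t 1.
    by rewrite (tnth_nth d) inordK.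
  have -> (t : 3.-tuple (og_structure GL)) : tnth t (inord 2) = nth d t 2.
    by rewrite (tnth_nth d) inordK.
  rewrite (tnth_nth d) /= og_ltNge og_leBB [_ + wL y']addrC [wL y' + _]addrC.
  by split=> [/negP/negPn//|h]; apply/negP/negPn.
(* The parameters in the value group are replaced by field elements with these values. *)
have /fin_all_exists2[c' c'0 ec'] : forall i : 'I_k, exists2 x : K, x != 0 & wK x = tnth c i.
  by move=> i; apply: vgrp_surj.
pose h b : (2 + k).-tuple K := [tuple of [tuple q b; q' b] ++ [tuple c' i | i < k]].
have Ph i : polyfun K m (fun b => tnth (h b) i).
  case: (split_ordP i) => [l ->|l ->]; last first.
    by apply: fr_ext (fr_cst _ (c' l)) => b; rewrite tnth_rshift tnth_mktuple.
  case: (unliftP ord0 l) => [l' ->|->].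
    by apply: fr_ext Pq' => b; rewrite tnth_lshift tnthS (ord1 l').
  by apply: fr_ext Pq => b; rewrite tnth_lshift.
have hpsi := qf_comp (fun f => polyfun_comp (f := f) Ph) (qf_og_sat ntK psi).
(* The case q' b = 0, of infinite value, is out of reach of a formula about the value group. *)
apply: qf_iff (qf_or (qf_eq0 DK Pq') hpsi) => b.
have eh : q b != 0 -> q' b != 0 -> map_tuple wK (h b) =
    [tuple of [tuple wK (q b); wK (q' b)] ++ c].
  move=> n n'; apply: val_inj => /=; congr [:: _, _ & _].
  rewrite -map_comp -[in RHS](map_tnth_enum c); apply: eq_map => i /=; exact: ec'.
have dvE : q b != 0 -> q' b != 0 ->
    DL (iota (q b) * y) (iota (q' b) * y') = (j (wK (q b)) + wL y <= j (wK (q' b)) + wL y').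
  by move=> n n'; rewrite dv_vgrp ?mulf_neq0 ?iota_eq0 // !vgrpM ?iota_eq0 // !vgrp_iota.
split=> [[->|[hn hs]]|].
- by rewrite rmorph0 mul0r dvx0.
- have n : q b != 0 by have := hn (lshift k ord0); rewrite tnth_lshift.
  have n' : q' b != 0 by have := hn (lshift k ord_max); rewrite tnth_lshift.
  by rewrite dvE //; apply/hcut; rewrite -eh.
have [->|n'] := eqVneq (q' b) 0; first by left.
have [->|n] := eqVneq (q b) 0.
  rewrite rmorph0 mul0r => /dv0x/eqP; rewrite mulf_eq0 iota_eq0 (negPf n') /=.
  by move/eqP => e; rewrite e eqxx in y'0.
rewrite dvE // => /hcut hs; right; split; last by rewrite eh.
move=> i; case: (split_ordP i) => [l ->|l ->]; last first.
  by rewrite tnth_rshift tnth_mktuple.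
rewrite tnth_lshift.
by case: (unliftP ord0 l) => [l' ->|->]; rewrite ?tnthS ?(ord1 l').
Qed.

(** On multiplying out, constants in L and entries of [a] go into the [l i], the variables [b] into
    polynomials over K. *)
Lemma polyfun_span n m (a : n.-tuple L) f : polyfun L (n + m) f ->
  exists (I : finType) (l : I -> L), exists2 p : I -> m.-tuple K -> K,
    forall i, polyfun K m (p i) &
    forall b, f [tuple of a ++ map_tuple iota b] = \sum_i iota (p i b) * l i.
Proof.
elim=> {f} [f g e _ [I [l [p Pp hp]]]|c|i
  |f g _ [I [l [p Pp hp]]] _ [J [r [q Pq hq]]]|f g _ [I [l [p Pp hp]]] _ [J [r [q Pq hq]]]].
- by exists I, l, p => // b; rewrite -e.
- exists unit, (fun=> c), (fun _ _ => 1) => [i|b]; first exact: (fr_cst (polyfun K m)).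
  by rewrite big_const card_unit /= rmorph1 mul1r addr0.
- case: (split_ordP i) => [k ->|k ->].
    exists unit, (fun=> tnth a k), (fun _ _ => 1) => [i'|b].
      exact: (fr_cst (polyfun K m)).
    by rewrite big_const card_unit /= rmorph1 mul1r addr0 tnth_lshift.
  exists unit, (fun=> 1), (fun _ b => tnth b k) => [i'|b]; first exact: polyfun_proj.
  by rewrite big_const card_unit /= mulr1 addr0 tnth_rshift tnth_map.
- exists (I + J)%type, (fun k => match k with inl i => l i | inr i => r i end).
  exists (fun k => match k with inl i => p i | inr i => q i end); first by case.
  by move=> b; rewrite big_sumType hp hq.
- exists (I * J)%type, (fun k => l k.1 * r k.2), (fun k b => p k.1 b * q k.2 b).
    by move=> k; apply: (fr_mul (Pp k.1) (Pq k.2)).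
  move=> b; rewrite hp hq big_distrlr /= pair_bigA /=.
  by apply: eq_bigr => k _; rewrite rmorphM mulrACA.
Qed.

(** The [l i] are expressed in a separated basis of their span, which makes the value of the sum a
    minimum. *)
Lemma polyfun_separated n m (a : n.-tuple L) f : polyfun L (n + m) f ->
  exists M (y : M.-tuple L), exists2 q : 'I_M -> m.-tuple K -> K,
    forall k, polyfun K m (q k) &
    forall b, vL (f [tuple of a ++ map_tuple iota b]) =
      \big[@vmin GL/None]_(k < M) vL (iota (q k b) * tnth y k).
Proof.
move=> /(polyfun_span (m := m) a)[I [l [p Pp hp]]].
have [M [y [[sp _] hy]]] := sep [tuple l (enum_val i) | i < #|I|].
have /fin_all_exists[k hk] : forall i : I, exists k : M.-tuple K, l i = lincomb iota k y.
  move=> i; apply/(sp (l i)); exists [tuple (i' == enum_rank i)%:R | i' < #|I|].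
  rewrite /lincomb (bigD1 (enum_rank i)) //= !tnth_mktuple eqxx rmorph1 mul1r enum_rankK.
  rewrite big1 ?addr0 // => i' ne; rewrite !tnth_mktuple (negPf ne) rmorph0 mul0r.
  by [].
exists M, y, (fun s b => \sum_i p i b * tnth (k i) s).
  move=> s; apply: (fr_sum (P := polyfun K m)) => i.
  exact: (fr_mul (Pp i) (fr_cst (polyfun K m) (tnth (k i) s))).
move=> b; have -> : f [tuple of a ++ map_tuple iota b] =
    lincomb iota [tuple \sum_i p i b * tnth (k i) s | s < M] y.
  rewrite hp /lincomb; under [RHS]eq_bigr => s _.
    rewrite tnth_mktuple rmorph_sum mulr_suml; under eq_bigr do rewrite rmorphM -mulrA.
    over.
  rewrite exchange_big /=; apply: eq_bigr => i _.
  by rewrite hk /lincomb mulr_sumr.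
by rewrite hy; apply: eq_bigr => s _; rewrite tnth_mktuple.
Qed.

Lemma qf_separated_trace n m (a : n.-tuple L) A : qf DL (polyfun L (n + m)) A ->
  qf DK (polyfun K m) (fun b => A [tuple of a ++ map_tuple iota b]).
Proof.
elim=> {A} [p q Pp Pq|A _ IH|A B _ IHA _ IHB|A B e _ IH]; first last.
- by apply: qf_iff IH => b; apply: e.
- exact: qf_and.
- exact: qf_not.
have [M [y [s Ps hs]]] := polyfun_separated a Pp.
have [M' [y' [s' Ps' hs']]] := polyfun_separated a Pq.
(* Comparison of two minima: every term of the second is infinite, as the comparison with 0
   expresses, or at least as large as some term of the first. *)
have := qf_all (fun k' : 'I_M' => qf_or
  (qf_cut 0 (tnth y' k') (fr_cst _ 0) (Ps' k'))
  (qf_ex (fun k : 'I_M => qf_cut (tnth y k) (tnth y' k') (Ps k) (Ps' k')))).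
apply: qf_iff => b; rewrite /= hs hs' vle_bigvmin; split.
  move=> h; apply/forallP => k'; have /= := h k'.
  have := vle_refl (\big[@vmin GL/None]_(k < M) vL (iota (s k b) * tnth y k)).
  rewrite vle_bigvmin => /forallP hmin.
  case=> [e|[k hk]]; last exact: vle_trans (hmin k) hk.
  have -> : vL (iota (s' k' b) * tnth y' k') = None; last by case: (\big[_/_]_(_ < _) _).
  by move: e; rewrite rmorph0 mul0r val0; case: (vL _).
move=> /forallP h k'; have /bigvmin_vle := h k'; case=> [e|[k hk]]; last by right; exists k.
by left; rewrite e; case: (vL _).
Qed.

Lemma T_of_separated n :
  @T vf_language n (vf_structure vK) (vf_structure vL) iota.
Proof.
move=> a m phi.
apply: pdef_definable; apply: pdef_qf.
exact: qf_separated_trace (qf_sat ntL phi).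
Qed.

End SeparatedToDefinable.

End Extension.

(** * From definability to separatedness *)

Section GenericLift.
Variables (K : closedFieldType) (D : vdiv K).

Definition monom m (mu : m.-tuple nat) (e : m.-tuple K) : K :=
  \prod_(i < m) tnth e i ^+ tnth mu i.

(** The coefficients with respect to the first variable are made generic by induction; then the
    first coordinate is multiplied by a unit generic for the resulting polynomials. The lists [ls]
    do not depend on [e]. *)
Lemma generic_lift m (I : finType) (p : I -> m.-tuple K -> K) :
  (forall i, polyfun K m (p i)) ->
  exists ls : I -> seq (K * m.-tuple nat), forall e : m.-tuple K, (forall i, tnth e i != 0) ->
    exists2 b : m.-tuple K, forall i, eqdv D (tnth b i) (tnth e i) &
      forall i z, D z (p i b) = all (fun x => D z (x.1 * monom x.2 e)) (ls i).
Proof.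
elim: m I p => [|m IH] I p hp.
  exists (fun i => [:: (p i [tuple], [tuple])]) => e _; exists e => [[]//|i z].
  by rewrite /= andbT /monom big_ord0 mulr1 tuple0.
have /fin_all_exists2[P PP eP] : forall i, exists2 P, polyc (polyfun K m) P &
    forall e : m.-tuple K * K, p i [tuple of e.2 :: e.1] = (P e.1).[e.2].
  by move=> i; have [P PP eP] := polyfun_cons (hp i); exists P.
have /fin_all_exists[N' hN'] : forall i, exists n, forall e, (size (P i e) <= n)%N.
  by move=> i; case: (PP i).
pose N := (\sum_i N' i)%N.
have hN i e : (size (P i e) <= N)%N.
  by apply: leq_trans (hN' i e) _; rewrite /N (bigD1 i) //= leq_addr.
have [ls' hls'] := IH (I * 'I_N)%type (fun ik e => (P ik.1 e)`_(ik.2))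
  (fun ik => (PP ik.1).2 ik.2).
pose consm (k : 'I_N) (x : K * m.-tuple nat) : K * m.+1.-tuple nat :=
  (x.1, [tuple of (k : nat) :: x.2]).
exists (fun i => flatten [seq [seq consm k x | x <- ls' (i, k)] | k <- enum 'I_N]).
move=> e he; pose t0 := thead e; pose e' : m.-tuple K := [tuple of behead e].
have ee : e = [tuple of t0 :: e'] by rewrite [LHS]tuple_eta; apply: val_inj.
have t00 : t0 != 0 by apply: he.
have he' i : tnth e' i != 0 by have := he (lift ord0 i); rewrite ee tnthS.
have [b' eb' hb'] := hls' e' he'.
have [Z hZ sZ] := unit_seq_exists D (size (flatten [seq roots_of (P i b') | i <- enum I])).+1.
have [|z zZ hz] := generic_unit (ss := flatten [seq roots_of (P i b') | i <- enum I]) hZ t00.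
  by rewrite sZ.
have ez : eqdv D (z * t0) t0.
  rewrite -[X in eqdv _ _ X]mul1r; apply: eqdv_mul (eqdv_refl _ _).
  by case: hZ => _ /(_ z zZ).
exists [tuple of z * t0 :: b'] => [i|i w].
  by rewrite ee; case: (unliftP ord0 i) => [i' ->|->]; rewrite ?tnthS ?tnth0.
rewrite (eP i (b', z * t0)) /=.
have zt0 : z * t0 != 0 by rewrite (eqdv_eq0 ez).
have gi : gauss_at D (P i b') (z * t0).
  apply: gauss_at_generic => // s si; apply: hz; apply/flattenP.
  by exists (roots_of (P i b')) => //; apply/map_f; rewrite mem_enum.
have key (k : 'I_N) : D w ((P i b')`_k * (z * t0) ^+ k) =
    all (fun x => D w ((consm k x).1 * monom (consm k x).2 e)) (ls' (i, k)).
  rewrite (eqdv_dvr _ (eqdv_mul (eqdv_refl D _) (eqdvX k ez))).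
  have tk : t0 ^+ k != 0 by rewrite expf_neq0.
  rewrite -{1}[w](divfK tk) dv_mul2r // (hb' (i, k)); apply: eq_all => x.
  rewrite -(dv_mul2r D _ _ tk) divfK // {2}/monom big_ord_recl ee !tnth0.
  congr (D w _); rewrite -mulrA; congr (_ * _); rewrite mulrC; congr (_ * _).
  by apply: eq_bigr => l _; rewrite !tnthS.
have -> : D w (P i b').[z * t0] =
    all (fun k : 'I_N => D w ((P i b')`_k * (z * t0) ^+ k)) (enum 'I_N).
  apply/idP/allP => [/(gi w) h k _|h]; first exact: h.
  apply/(gi w) => k; have [lt|ge] := ltnP k N.
    by apply: (h (Ordinal lt)); rewrite mem_enum.
  by rewrite nth_default ?(leq_trans (hN i b')) // mul0r dvx0.
by elim: (enum 'I_N) => //= k s IHs; rewrite all_cat IHs all_map key.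
Qed.

(** The least value in the list is attained; [y == 0] accounts for the empty list, which forces x =
    0. *)
Lemma dv_min_list (T : Type) (l : seq T) (F : T -> K) x y :
  (forall z, D z x = all (fun a => D z (F a)) l) ->
  D x y = (y == 0) || has (fun a => D (F a) y) l.
Proof.
move=> h; apply/idP/orP => [xy|[/eqP ->|]]; first last.
- have := h x; rewrite dvxx => /esym; elim: (l) => //= a s IH /andP[xa /IH hs].
  by case/orP => // ay; apply: dv_trans xa ay.
- exact: dvx0.
have [->|y0] := eqVneq y 0; [by left | right].
apply/negPn/negP => nh; have : D y x.
  rewrite h; elim: (l) nh => //= a s IH; rewrite negb_or => /andP[na /IH ->].
  by rewrite andbT; apply: sdvW.
move=> yx; have : has predT (map F l).
  apply/negPn/negP => nl; have := h 0; have -> : l = [::] by case: (l) nl.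
  by move=> /dv0x x0; move: xy; rewrite x0 => /dv0x/eqP; rewrite (negPf y0).
move=> hs; have [w /andP[wl _] hw] := dv_seq_min D hs.
have wx : D w x.
  rewrite h; elim: (l) hw => //= a s IH hw; rewrite hw ?mem_head // IH //.
  by move=> b bs _; apply: hw; rewrite // inE bs orbT.
case/negP: nh; elim: (l) wl => //= a s IH; rewrite inE => /predU1P[<-|/IH ->].
  by rewrite (dv_trans wx).
by rewrite orbT.
Qed.

End GenericLift.

Lemma Exists_has (T : Type) (P : T -> Prop) (p : pred T) (s : seq T) :
  (forall x, P x <-> p x) -> List.Exists P s <-> has p s.
Proof.
move=> h; elim: s => [|x s IH] /=; first by split=> // /List.Exists_nil.
by rewrite List.Exists_cons h IH; split=> /orP.
Qed.

Lemma Forall_all (T : Type) (P : T -> Prop) (p : pred T) (s : seq T) :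
  (forall x, P x <-> p x) -> List.Forall P s <-> all p s.
Proof.
move=> h; elim: s => [|x s IH] /=; first by split.
by rewrite List.Forall_cons_iff h IH; split=> /andP.
Qed.

Section PdefFin.
Variables (S : language) (M : structure S).

Lemma pdef_ex n (I : finType) (A : I -> n.-tuple M -> Prop) :
  (forall i, pdef (A i)) -> pdef (fun e => exists i, A i e).
Proof.
move=> /(pdef_ex_seq (enum I)); apply: pdef_iff => e; rewrite List.Exists_exists.
split=> [[i [_ h]]|[i h]]; exists i => //; split=> //.
have : i \in enum I by rewrite mem_enum.
by elim: (enum I) => //= a s IH; rewrite inE => /predU1P[->|/IH]; [left | right].
Qed.

Lemma pdef_all n (I : finType) (A : I -> n.-tuple M -> Prop) :
  (forall i, pdef (A i)) -> pdef (fun e => forall i, A i e).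
Proof.
move=> h; have := pdef_not (pdef_ex (fun i => pdef_not (h i))); apply: pdef_iff => e.
split=> [ne i|hi [i]]; last by apply.
by apply: NNPP => ni; apply: ne; exists i.
Qed.

End PdefFin.

(** * Traces on K of definable sets over L *)

Section Trace.
Variables (K L : closedFieldType) (GK GL : orderedGroupType)
    (vK : valuation K GK) (vL : valuation L GL)
    (iota : {rmorphism K -> L}) (j : {additive GK -> GL})
    (ntK : nontrivial vK) (ntL : nontrivial vL)
    (vext : valued_extension vK vL iota j)
    (hT : forall n : nat, (1 <= n)%N ->
       @T vf_language n (vf_structure vK) (vf_structure vL) iota).
Local Notation DK := (vdiv_of vK).
Local Notation DL := (vdiv_of vL).
Local Notation wK := (vgrp vK).
Local Notation wL := (vgrp vL).
Local Notation OG_K := (og_structure GK).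
Local Notation pterm_og m := (@pterm og_language OG_K m).
Local Notation pdef_og m := (@pdef og_language OG_K m).

Lemma polyfun_cat n m (c : m.-tuple K) f : polyfun K (n + m) f ->
  polyfun K n (fun b => f [tuple of b ++ c]).
Proof.
apply: polyfun_comp => i; case: (split_ordP i) => [l ->|l ->].
  by apply: fr_ext (fr_proj K l) => b; rewrite tnth_lshift.
by apply: fr_ext (fr_cst _ (tnth c l)) => b; rewrite tnth_rshift.
Qed.

(** The parameters of [A] in L form a tuple, whose type over K is definable. *)
Lemma qf_trace m A : qf DL (polyfun L m) A ->
  qf DK (polyfun K m) (fun b => A (map_tuple iota b)).
Proof.
move=> /pdef_qf[I [c H]].
have [phi hphi] := H (#|I|.+1 + m)%N (fun i => lshift m (lift ord0 (enum_rank i)))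
  (fun l => rshift #|I|.+1 l).
(* The entry 0 makes the tuple nonempty, as [hT] requires. *)
pose a : #|I|.+1.-tuple L := [tuple of 0 :: [tuple c (enum_val i) | i < #|I|]].
have [k [psi [d hd]]] := hT (isT : (1 <= #|I|.+1)%N) a phi.
have := qf_comp (fun f => @polyfun_cat m k d f) (qf_sat ntK psi); apply: qf_iff => b.
rewrite -hd /tp hphi.
  suff -> : [tuple tnth [tuple of a ++ map_tuple iota b] (rshift #|I|.+1 i) | i < m] =
    map_tuple iota b by [].
  by apply: eq_from_tnth => i; rewrite tnth_mktuple tnth_rshift.
by move=> i; rewrite tnth_lshift tnthS tnth_mktuple enum_rankK.
Qed.

Lemma pterm_og_linear m (g0 : GK) (mu : m.-tuple nat) :
  pterm_og m (fun g => g0 + \sum_(i < m) tnth g i *+ tnth mu i).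
Proof.
have addP (f f' : m.-tuple GK -> GK) : pterm_og m f ->
    pterm_og m f' ->
    pterm_og m (fun g => f g + f' g).
  move=> pf pf'; pose h (i : 'I_2) := if i == ord0 then f else f'.
  have H := @pterm_app og_language OG_K m OgAdd h.
  apply: pterm_eq (H _) => [e|i]; first by rewrite /= !tnth_mktuple.
  by rewrite /h; case: ifP.
have zP : pterm_og m (fun=> (0 : GK)) := @pterm_cst og_language OG_K m 0.
have mulP i n : pterm_og m (fun g => (tnth g i : GK) *+ n).
  elim: n => [|n IH]; first by apply: pterm_eq zP => e; rewrite mulr0n.
  by apply: pterm_eq (addP _ _ (@pterm_proj og_language OG_K m i) IH) => e; rewrite mulrS.
refine (addP _ _ _ _); first exact: (@pterm_cst og_language OG_K m g0).
elim: (index_enum _) => [|i s IH].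
  by apply: pterm_eq zP => e; rewrite big_nil.
by apply: pterm_eq (addP _ _ (mulP i (tnth mu i)) IH) => e; rewrite big_cons.
Qed.

Lemma pdef_og_le m (f f' : m.-tuple GK -> GK) :
  pterm_og m f -> pterm_og m f' ->
  pdef_og m (fun g => f g <= f' g).
Proof.
move=> pf pf'; pose h (i : 'I_2) := if i == ord0 then f' else f.
have H := @pdef_rel og_language OG_K m OgLt h.
apply: pdef_iff (pdef_not (H _)) => [e|i]; last by rewrite /h; case: ifP.
by rewrite /= !tnth_mktuple /= og_ltNge; split=> [/negP/negPn//|h']; apply/negP/negPn.
Qed.

Lemma monom_neq0 m (mu : m.-tuple nat) (e : m.-tuple K) :
  (forall i, tnth e i != 0) -> monom mu e != 0.
Proof. by move=> he; apply/prodf_neq0 => i _; rewrite expf_neq0. Qed.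

Lemma vgrp_monom m (mu : m.-tuple nat) (e : m.-tuple K) :
  (forall i, tnth e i != 0) ->
  wK (monom mu e) = \sum_(i < m) tnth (map_tuple wK e) i *+ tnth mu i.
Proof.
move=> he; have wX x n : x != 0 -> wK (x ^+ n) = wK x *+ n.
  move=> x0; elim: n => [|n IH]; first by rewrite vgrp1.
  by rewrite exprS vgrpM ?expf_neq0 // IH mulrS.
suff [] : monom mu e != 0 /\
  wK (monom mu e) = \sum_(i < m) tnth (map_tuple wK e) i *+ tnth mu i by [].
rewrite /monom; elim/big_ind2: _ => [|x g y h [x0 ex] [y0 ey]|i _].
- by rewrite oner_neq0 vgrp1.
- by rewrite mulf_neq0 // vgrpM // ex ey.
- by rewrite expf_neq0 // wX // tnth_map.
Qed.

(** The set of g with phi(a, g) is pulled back under v and traced on K. The trace [A] depends on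
    values only, so it can be tested at generic lifts, where polynomials are compared through minima
    of linear functions of g. *)
Lemma T1_of_T : @T og_language 1 (og_structure GK) (og_structure GL) j.
Proof.
move=> a m phi; apply: pdef_definable.
have [x x0 ex] := vgrp_surj vL (tnth a ord0).
pose h (e : m.-tuple L) : (1 + m).-tuple L := [tuple of [tuple x] ++ e].
have Ph i : polyfun L m (fun e => tnth (h e) i).
  case: (split_ordP i) => [l ->|l ->].
    by apply: fr_ext (fr_cst _ x) => e; rewrite tnth_lshift (ord1 l).
  by apply: fr_ext (fr_proj L l) => e; rewrite tnth_rshift.
have := qf_trace (qf_comp (fun f => polyfun_comp (f := f) Ph) (qf_og_sat ntL phi)).
set A := fun b => _ /\ _ => qA.
have hA b : (forall i, tnth b i != 0) ->
    A b <-> @tp og_language OG_K (og_structure GL) j 1 a m phi (map_tuple wK b).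
  move=> hb; rewrite /A /tp.
  have -> : map_tuple wL (h (map_tuple iota b)) =
      [tuple of a ++ map_tuple (j : og_structure GK -> og_structure GL) (map_tuple wK b)].
    apply: eq_from_tnth => i; rewrite tnth_map; case: (split_ordP i) => [l ->|l ->].
      by rewrite !tnth_lshift (ord1 l).
    by rewrite !tnth_rshift !tnth_map (vgrp_iota vext).
  split=> [[]//|hs]; split=> // i; case: (split_ordP i) => [l ->|l ->].
    by rewrite tnth_lshift (ord1 l).
  by rewrite tnth_rshift tnth_map fmorph_eq0.
have [I [p [Pp hp]]] := qf_finite qA.
have [ls hls] := generic_lift DK Pp.
pose cmp (y z : K * m.-tuple nat) (g : m.-tuple GK) :=
  wK y.1 + \sum_(i < m) tnth g i *+ tnth y.2 i <= wK z.1 + \sum_(i < m) tnth g i *+ tnth z.2 i.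
(* [R (i, k) g] says that v(p_i) <= v(p_k) at generic lifts of [g]. *)
pose R (ik : I * I) (g : m.-tuple GK) := List.Forall (fun z => z.1 = 0 \/
  List.Exists (fun y => y.1 != 0 /\ cmp y z g) (ls ik.1)) (ls ik.2).
have pR ik : pdef_og m (R ik).
  apply: pdef_all_seq => z; apply: pdef_or (pdef_cst _ _ _) _; apply: pdef_ex_seq => y.
  by apply: pdef_and (pdef_cst _ _ _) _; apply: pdef_og_le; apply: pterm_og_linear.
(* By [hp], [A] is determined by the pattern of comparisons; [good] selects the patterns occurring
   in [A], a condition without variables. *)
pose good (t : {ffun I * I -> bool}) := exists2 b, A b &
  forall ik, DK (p ik.1 b) (p ik.2 b) = t ik.
pose B (g : m.-tuple GK) := exists t : {ffun I * I -> bool},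
  good t /\ forall ik, (R ik g -> t ik) /\ (t ik -> R ik g).
have pB : pdef_og m B.
  apply: pdef_ex => t; apply: pdef_and (pdef_cst _ _ _) _; apply: pdef_all => ik.
  by apply: pdef_and; apply: pdef_imp => //; apply: pdef_cst.
apply: pdef_iff pB => g.
have /fin_all_exists2[e' he' ge'] : forall i : 'I_m, exists2 e, e != 0 & wK e = tnth g i.
  by move=> i; apply: vgrp_surj.
pose e := [tuple e' i | i < m].
have he i : tnth e i != 0 by rewrite tnth_mktuple.
have ge : map_tuple wK e = g by apply: eq_from_tnth => i; rewrite tnth_map tnth_mktuple.
have [b eb hb] := hls e he.
have nb i : tnth b i != 0 by rewrite (eqdv_eq0 (eb i)).
have gb : map_tuple wK b = g.
  apply: eq_from_tnth => i; rewrite -ge !tnth_map; apply/le_anti.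
  by rewrite -!dv_vgrp ?tnth_ord_tuple //; have := eb i; rewrite tnth_mktuple.
have hR ik : R ik g <-> DK (p ik.1 b) (p ik.2 b).
  rewrite hb /R; have cmpE y z : z.1 != 0 -> (y.1 != 0 /\ cmp y z g) <->
      DK (y.1 * monom y.2 e) (z.1 * monom z.2 e).
    move=> z0; have mz := mulf_neq0 z0 (monom_neq0 z.2 he).
    have [y0|y0] := eqVneq y.1 0.
      by split=> [[]//|]; rewrite y0 mul0r => /dv0x/eqP; rewrite (negPf mz).
    have my := mulf_neq0 y0 (monom_neq0 y.2 he).
    rewrite dv_vgrp // !vgrpM ?monom_neq0 // !vgrp_monom // ge /cmp.
    by split=> [[]|].
  have main z : (z.1 = 0 \/ List.Exists (fun y => y.1 != 0 /\ cmp y z g) (ls ik.1)) <->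
      DK (p ik.1 b) (z.1 * monom z.2 e).
    rewrite (dv_min_list (l := ls ik.1) (F := fun x => x.1 * monom x.2 e) _ (hb ik.1)).
    rewrite mulf_eq0 (negPf (monom_neq0 z.2 he)) orbF.
    have [z0|z0] := eqVneq z.1 0; first by split=> // _; left.
    rewrite orFb -(Exists_has (ls ik.1) (fun y => cmpE y z z0)).
    by split=> [[/eqP|//]|hs]; [rewrite (negPf z0) | right].
  exact: Forall_all.
rewrite -gb; apply: iff_trans (hA b nb).
split=> [[t [[b0 Ab0 ht] hRt]]|Ab].
  apply/(hp b b0) => // i k; rewrite (ht (i, k)); apply/idP/idP.
    by move/(hR (i, k)); rewrite -gb => /((hRt (i, k)).1).
  by move/((hRt (i, k)).2); rewrite gb => /(hR (i, k)).
exists [ffun ik => DK (p ik.1 b) (p ik.2 b)]; split.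
  by exists b => // ik; rewrite ffunE.
by move=> ik; rewrite ffunE gb hR.
Qed.

End Trace.

(** * Definable spherical completeness *)

Section Spherical.
Variables (K : closedFieldType) (D : vdiv K).

(** For a root x outside the ball, v(t' - x) < v(d) <= v(t - t'), so t - x and t' - x have the same
    value. *)
Lemma eqdv_horner_ball (g : {poly K}) d t t' : D d (t - t') ->
  (forall x, root g x -> ~~ D d (t' - x)) -> eqdv D g.[t] g.[t'].
Proof.
move=> dt hg; have [->|g0] := eqVneq g 0; first by rewrite !horner0 eqdv_refl.
rewrite (roots_ofE g) !hornerZ !horner_prod; apply: eqdv_mul (eqdv_refl _ _) _.
rewrite !big_seq; elim/big_ind2: _ => [|x y x' y'|x xg]; first exact: eqdv_refl.
  exact: eqdv_mul.
rewrite !hornerXsubC; have -> : t - x = (t' - x) + (t - t') by ring.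
apply: eqdv_add; apply: sdv_dv_trans dt; apply: hg.
by rewrite -mem_roots_of.
Qed.

(** In a vanishing sum with a nonzero term, the least value is attained at least twice. *)
Lemma sum_eq0_eqdv n (x : 'I_n -> K) i : \sum_l x l = 0 -> x i != 0 ->
  exists l1 l2 : 'I_n, [/\ (l1 < l2)%N, x l1 != 0, x l2 != 0 & eqdv D (x l1) (x l2)].
Proof.
move=> sx xi; have hs : has predT [seq x l | l <- enum 'I_n].
  by apply/hasP; exists (x i) => //; apply: map_f; rewrite mem_enum.
have [_ /andP[/mapP[l _ ->] _] hl] := dv_seq_min D hs.
have {}hl l' : D (x l) (x l').
  by apply: hl => //; apply: map_f; rewrite mem_enum.
have xl : x l != 0 := dv_neq0 (hl i) xi.
have [l' ne e] : exists2 l', l' != l & D (x l') (x l).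
  apply: NNPP => h; have : eqdv D (x l + \sum_(l' | l' != l) x l') (x l).
    apply: eqdv_add; apply: sdv_sum => // l' ne; apply/negP => e.
    by apply: h; exists l'.
  by move: sx; rewrite (bigD1 l) //= => -> /eqdv_eq0; rewrite eqxx (negPf xl).
have xl' : x l' != 0 := dv_neq0 e xl.
case: (ltngtP l l') => [lt|lt|/ord_inj ee]; last by rewrite ee eqxx in ne.
  by exists l, l'; split=> //; rewrite /eqdv e hl.
by exists l', l; split=> //; rewrite /eqdv e hl.
Qed.

Lemma polyfun1_poly f : polyfun K 1 f -> exists p : {poly K}, forall d, f [tuple d] = p.[d].
Proof.
elim=> {f} [f g e _ [p hp]|c|i|f g _ [p hp] _ [q hq]|f g _ [p hp] _ [q hq]].
- by exists p => d; rewrite -e.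
- by exists c%:P => d; rewrite hornerC.
- by exists 'X => d; rewrite hornerX (ord1 i).
- by exists (p + q) => d; rewrite hornerD hp hq.
- by exists (p * q) => d; rewrite hornerM hp hq.
Qed.

(** The nonempty [B d] are closed balls of radius v(d), shrinking as v(d) grows; no point lies in
    all of those with [d != 0]. *)
Variable S : 1.-tuple K * K -> Prop.
Hypothesis qS : qf D (ext (polyfun K 1)) S.
Local Notation B d t := (S ([tuple d], t)).
Hypothesis ball : forall d t t', B d t -> (B d t' <-> D d (t - t')).
Hypothesis mono : forall d d' t, D d d' -> B d' t -> B d t.
Hypothesis empty : forall t, exists d t', [/\ d != 0, B d t' & ~ B d t].

Let shrink d t : B d t -> exists d' t', sdv D d d' /\ B d' t'.
Proof.
move=> hB; have [d' [t' [_ hB' nB]]] := empty t; exists d', t'; split=> //.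
by apply/negP => h; apply: nB; apply: mono hB.
Qed.

(** Of two balls of the chain, the smaller avoids what either avoids. *)
Let avoid (s : seq K) : exists d t, [/\ d != 0, B d t & forall x, x \in s -> ~ B d x].
Proof.
elim: s => [|x s [d1 [t1 [d10 h1 n1]]]].
  by have [d [t [d0 h _]]] := empty 0; exists d, t.
have [d2 [t2 [d20 h2 n2]]] := empty x.
case/orP: (dv_total D d1 d2) => le.
  exists d2, t2; split=> // x'; rewrite inE => /predU1P[-> //|/n1 h h'].
  by apply: h; apply: mono h'.
exists d1, t1; split=> // x'; rewrite inE => /predU1P[-> h|/n1//].
by apply: n2; apply: mono h.
Qed.

(* The polynomials [p(d, t)] defining [S], expanded as [sum_l a_l(t) d^l], have
   coefficients of constant value on a small enough ball [B d0].  If v([d]) is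
   larger than v([d0]), some [p(d, t)] vanishes at a point of [B d0], for otherwise
   [B d0] would be contained in [B d]; then two terms [a_l(t) d^l] have the same
   value, which leaves finitely many possibilities for v([d]). *)
Lemma no_empty_chain : False.
Proof.
have [I [f [Pf hf]]] := qf_finite qS.
have /fin_all_exists2[P PP eP] : forall i : I, exists2 p, polyc (polyfun K 1) p &
  forall e, f i e = (p e.1).[e.2] by [].
have /fin_all_exists[N' hN'] : forall i, exists n, forall e, (size (P i e) <= n)%N.
  by move=> i; case: (PP i).
pose N := (\sum_i N' i)%N.
have hN i e : (size (P i e) <= N)%N.
  by apply: leq_trans (hN' i e) _; rewrite /N (bigD1 i) //= leq_addr.
have /fin_all_exists[r hr] : forall ik : I * 'I_N, exists q : {poly K},
    forall d, (P ik.1 [tuple d])`_(ik.2) = q.[d].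
  by move=> ik; apply: (polyfun1_poly ((PP ik.1).2 ik.2)).
pose M := (\sum_ik size (r ik))%N.
have hM ik : (size (r ik) <= M)%N by rewrite /M (bigD1 ik) //= leq_addr.
(* [a (i, l)] is the coefficient of d^l in the i-th polynomial, as a polynomial in t. *)
pose a (il : I * 'I_M) : {poly K} := \sum_(k < N) (r (il.1, k))`_(il.2) *: 'X^k.
have expand i d t : (P i [tuple d]).[t] = \sum_(l < M) (a (i, l)).[t] * d ^+ l.
  rewrite (horner_bound _ (hN i _)).
  under [RHS]eq_bigr => l _ do rewrite /a horner_sum mulr_suml.
  rewrite exchange_big /=; apply: eq_bigr => k _.
  rewrite (hr (i, k)) (horner_bound _ (hM (i, k))) mulr_suml; apply: eq_bigr => l _.
  by rewrite !hornerE mulrAC.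
(* [B d0] contains no root of a nonzero [a il], so each [a il] has constant value there. *)
have [d0 [t0 [d00 ht0 hd0]]] := avoid (flatten [seq roots_of (a il) | il <- enum {: I * 'I_M}]).
have aroot il t : a il != 0 -> root (a il) t -> ~ B d0 t.
  move=> a0 rt; apply: hd0; apply/flattenP; exists (roots_of (a il)).
    by apply/map_f; rewrite mem_enum.
  by rewrite mem_roots_of.
have root_near d : sdv D d0 d -> (exists t, B d t) ->
    exists i t1, [/\ B d0 t1, P i [tuple d] != 0 & root (P i [tuple d]) t1].
  move=> lt [t ht]; apply: NNPP => none.
  have same i t' : B d0 t' -> eqdv D (P i [tuple d]).[t] (P i [tuple d]).[t'].
    move=> ht'; have [->|Pi0] := eqVneq (P i [tuple d]) 0.
      by rewrite !horner0 eqdv_refl.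
    apply: (@eqdv_horner_ball _ d0); first by apply/(ball t' (mono (sdvW lt) ht)).
    move=> x rx; apply/negP => hx; apply: none; exists i, x; split=> //.
    by apply/(ball x ht').
  (* If all polynomials kept their values on [B d0], the point [t + d0] of [B d0], too far from [t]
     for [B d], would lie in [B d]. *)
  have ht0' : B d0 (t + d0).
    by apply/(ball _ (mono (sdvW lt) ht)); rewrite opprD addrA subrr add0r dvNr dvxx.
  have : B d (t + d0).
    apply/(hf ([tuple d], t)) => // i k; rewrite !eP /=.
    by rewrite (eqdv_dvl _ (same i _ ht0')) (eqdv_dvr _ (same k _ ht0')).
  move/(ball _ ht); rewrite opprD addrA subrr add0r dvNr => h.
  by rewrite /sdv h in lt.
(* [w x] has the radius at which two given terms have the same value, with coefficients taken at
   [t0]. *)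
have /fin_all_exists[w hw] : forall x : (I * 'I_M) * (I * 'I_M), exists w : K,
    (a x.1).[t0] != 0 -> (a x.2).[t0] != 0 -> (x.1.2 < x.2.2)%N ->
    (a x.2).[t0] * w ^+ (x.2.2 - x.1.2) = (a x.1).[t0].
  move=> x; have [w ew] := nth_root_exists (x.2.2 - x.1.2).-1 ((a x.1).[t0] / (a x.2).[t0]).
  exists w => n1 n2 lt; rewrite prednK ?subn_gt0 // in ew.
  by rewrite ew mulrC divfK.
pose W := [seq w x | x <- enum {: (I * 'I_M) * (I * 'I_M)}].
have finite d : sdv D d0 d -> (exists t, B d t) -> exists2 x, x \in W & eqdv D x d.
  move=> lt hd; have [i [t1 [ht1 Pi0 /rootP rt1]]] := root_near d lt hd.
  have anz l : a (i, l) != 0 -> (a (i, l)).[t1] != 0.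
    by move=> al; apply/negP => /(aroot _ _ al).
  have [l al] : exists l, a (i, l) != 0.
    apply: NNPP => h; case/negP: Pi0; apply/eqP/(poly_ext_eq0 D) => t.
    rewrite expand big1 // => l _; have [->|al] := eqVneq (a (i, l)) 0.
      by rewrite horner0 mul0r.
    by case: h; exists l.
  have dn0 : d != 0.
    apply/eqP => d0'; have [t2 ht2] := hd; have [d' [t' [d'0 _ nB]]] := empty t2.
    by apply: nB; apply: mono ht2; rewrite d0' dvx0.
  rewrite expand in rt1.
  have nz : (a (i, l)).[t1] * d ^+ l != 0 by rewrite mulf_neq0 ?anz ?expf_neq0.
  have [l1 [l2 [lt12 n1 n2 e]]] := sum_eq0_eqdv (x := fun l => (a (i, l)).[t1] * d ^+ l) rt1 nz.
  have al0 l' : (a (i, l')).[t1] * d ^+ l' != 0 -> a (i, l') != 0.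
    by apply: contraNneq => ->; rewrite horner0 mul0r.
  have same l' : a (i, l') != 0 -> eqdv D (a (i, l')).[t1] (a (i, l')).[t0].
    move=> an0; apply: (@eqdv_horner_ball _ d0); first by apply/(ball t0 ht1).
    by move=> x rx; apply/negP => /(ball x ht0); apply: aroot rx.
  have m1 : (a (i, l1)).[t0] != 0 by rewrite -(eqdv_eq0 (same _ (al0 _ n1))) anz ?al0.
  have m2 : (a (i, l2)).[t0] != 0 by rewrite -(eqdv_eq0 (same _ (al0 _ n2))) anz ?al0.
  exists (w ((i, l1), (i, l2))); first by apply: map_f; rewrite mem_enum.
  have := hw ((i, l1), (i, l2)) m1 m2 lt12; set u := w _ => /= eu.
  have {}e : eqdv D (a (i, l1)).[t0] ((a (i, l2)).[t0] * d ^+ (l2 - l1)).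
    have e1 := eqdv_mul (same _ (al0 _ n1)) (eqdv_refl D (d ^+ l1)).
    have e2 := eqdv_mul (same _ (al0 _ n2)) (eqdv_refl D (d ^+ l2)).
    have : eqdv D ((a (i, l1)).[t0] * d ^+ l1) ((a (i, l2)).[t0] * d ^+ l2).
      by apply: eqdv_trans e2; apply: eqdv_trans e; rewrite eqdv_sym.
    rewrite -[in d ^+ l2](subnK (ltnW lt12)) exprD mulrA /eqdv.
    by rewrite !dv_mul2r ?expf_neq0.
  move: e; rewrite -eu /eqdv !dv_mul2l // -[(l2 - l1)%N]prednK ?subn_gt0 //.
  by rewrite !dvXE.
have [d1 [t1 [lt1 ht1]]] := shrink ht0.
(* [w0] has the least value above v(d0) among [W] and [d1]; a [d] halfway between contradicts
   [finite]. Including [d1] ensures that [B d] is nonempty. *)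
have hs : has (sdv D d0) (d1 :: W) by rewrite /= lt1.
have [w0 /andP[_ lt0] hw0] := dv_seq_min D hs.
have [d ed] := nth_root_exists 1 (d0 * w0).
have w00 : w0 != 0 by apply: dv_neq0 (hw0 d1 (mem_head _ _) lt1) _; apply/eqP => e;
  have [d' [t' [_ _ nB]]] := empty t1; apply: nB; apply: mono ht1; rewrite e dvx0.
have lt0d : sdv D d0 d.
  by rewrite /sdv -(dvXE D 1) ed expr2 -/(sdv D _ _) sdv_mul2l.
have ltdw : sdv D d w0.
  by rewrite /sdv -(dvXE D 1) ed expr2 -/(sdv D _ _) sdv_mul2r.
have [x xW /andP[xd dx]] : exists2 x, x \in W & eqdv D x d.
  apply: finite => //; exists t1; apply: mono ht1.
  by apply: dv_trans (sdvW ltdw) (hw0 d1 (mem_head _ _) lt1).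
have : D w0 x by apply: hw0; [rewrite inE xW orbT | apply: sdv_dv_trans lt0d dx].
by move=> w0x; move: ltdw; rewrite /sdv (dv_trans w0x xd).
Qed.

End Spherical.

(** * Closest vectors and separated bases *)

Section SeparatedBasis.
Variables (K L : closedFieldType) (GK GL : orderedGroupType)
    (vK : valuation K GK) (vL : valuation L GL)
    (iota : {rmorphism K -> L}) (j : {additive GK -> GL})
    (ntK : nontrivial vK) (ntL : nontrivial vL)
    (vext : valued_extension vK vL iota j)
    (hT : forall n : nat, (1 <= n)%N ->
       @T vf_language n (vf_structure vK) (vf_structure vL) iota).
Local Notation DK := (vdiv_of vK).
Local Notation DL := (vdiv_of vL).

Lemma qf_ex_cat m n (A : (m + n).-tuple K -> Prop) : qf DK (polyfun K (m + n)) A ->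
  qf DK (polyfun K n) (fun e => exists k : m.-tuple K, A [tuple of k ++ e]).
Proof.
elim: m A => [|m IH] A hA.
  apply: qf_iff hA => e; have e0 : [tuple of [tuple] ++ e] = e by apply: val_inj.
  by split=> [h|[k]]; [exists [tuple]; rewrite e0 | rewrite (tuple0 k) e0].
have /IH := qf_ex_cons ntK (hA : qf DK (polyfun K (m + n).+1) A); apply: qf_iff => e.
split=> [[k [x h]]|[k h]].
  by exists [tuple of x :: k]; move: h; congr A; apply: val_inj.
exists [tuple of behead k], (thead k); move: h; congr A; apply: val_inj => /=.
by rewrite {1}(tuple_eta k).
Qed.

Lemma lincombB m (k k' : m.-tuple K) (y : m.-tuple L) :
  lincomb iota [tuple tnth k i - tnth k' i | i < m] y = lincomb iota k y - lincomb iota k' y.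
Proof.
rewrite /lincomb -sumrB; apply: eq_bigr => i _.
by rewrite tnth_mktuple rmorphB mulrBl.
Qed.

Lemma dv_lincomb m (k : m.-tuple K) (y : m.-tuple L) c : separated_seq iota vL y ->
  DL c (lincomb iota k y) <-> forall i, DL c (iota (tnth k i) * tnth y i).
Proof.
by move=> hy; rewrite /= hy vle_bigvmin; split=> [/forallP|h]; last apply/forallP.
Qed.

(* Without a closest vector, the sets of the [k'] with
   v([X k]) <= v(sum_i (k'_i - k_i) y_i) are products of balls, nested and with
   empty intersection; in some coordinate the balls have empty intersection. *)
Lemma closest_vector m (y : m.-tuple L) (x0 : L) : separated_seq iota vL y ->
  (forall i, tnth y i != 0) ->
  exists k : m.-tuple K, forall k' : m.-tuple K,
    DL (x0 - lincomb iota k' y) (x0 - lincomb iota k y).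
Proof.
move=> hy y0; pose X (k : m.-tuple K) := x0 - lincomb iota k y.
apply: NNPP => nmax.
have {}nmax k : exists k', sdv DL (X k) (X k').
  apply: NNPP => h; apply: nmax; exists k => k'; apply/negPn/negP => hk.
  by apply: h; exists k'.
(* For fixed [k], these [t] form the ball about k_i of radius v(X k) - v(y_i), a radius in vL. *)
pose R i (t : K) (k : m.-tuple K) : bool := DL (X k) (iota (t - tnth k i) * tnth y i).
have Rcenter i k : R i (tnth k i) k by rewrite /R subrr rmorph0 mul0r dvx0.
have XB k k' : X k - X k' = lincomb iota [tuple tnth k' i - tnth k i | i < m] y.
  by rewrite lincombB /X; ring.
have center i k k' : DL (X k) (X k') -> R i (tnth k' i) k.
  move=> h; have : DL (X k) (X k - X k') by apply: dv_sub (dvxx _ _) h.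
  by rewrite XB dv_lincomb // => /(_ i); rewrite tnth_mktuple.
(* Common points of the balls, one in each coordinate, would form a vector at least as close to [x0]
   as any other. *)
have [i hi] : exists i, forall t, exists k, ~~ R i t k.
  apply: NNPP => h; have /fin_all_exists[t ht] : forall i : 'I_m, exists t, forall k, R i t k.
    move=> i; apply: NNPP => h'; apply: h; exists i => t; apply: NNPP => h''.
    by apply: h'; exists t => k; apply/negPn/negP => hk; apply: h''; exists k.
  have [k' hk'] := nmax [tuple t i | i < m].
  have : DL (X k') (X k' - X [tuple t i | i < m]).
    by rewrite XB dv_lincomb // => i; rewrite !tnth_mktuple; apply: ht.
  move=> h1; have : DL (X k') (X k' - (X k' - X [tuple t i | i < m])).
    by apply: dv_sub (dvxx _ _) h1.
  by rewrite opprB addrC subrK; apply/negP.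
(* Radii have to be in vK: [S d] is the ball of radius v(d) containing some ball of the chain, if
   there is one. *)
pose S d t := d != 0 /\ exists k, forall t', R i t' k -> DK d (t - t').
have qR : qf DK (polyfun K m.+1) (fun e => R i (thead e) [tuple of behead e]).
  pose XL (e : m.+1.-tuple L) := x0 - \sum_(l < m) tnth e (lift ord0 l) * tnth y l.
  have := qf_trace ntK hT (qf_dv DL (p := XL)
    (q := fun e => (tnth e ord0 - tnth e (lift ord0 i)) * tnth y i)
    (fr_sub (fr_cst (polyfun L m.+1) _)
       (fr_sum _ _ (fun l => fr_mul (fr_proj L (lift ord0 l)) (fr_cst _ (tnth y l)))))
    (fr_mul (fr_sub (fr_proj L ord0) (fr_proj L (lift ord0 i))) (fr_cst _ (tnth y i)))).
  apply: qf_iff => e; rewrite /R /X /lincomb rmorphB !tnth_map tnth_behead.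
  have -> : lift ord0 i = inord i.+1 by apply: val_inj; rewrite /= inordK // ltnS.
  rewrite /XL; under eq_bigr => l _ do rewrite tnth_map.
  under [X in _ <-> is_true (dv _ (x0 - X) _)]eq_bigr => l _.
    rewrite tnth_behead.
    have -> : inord l.+1 = lift ord0 l by apply: val_inj; rewrite /= inordK // ltnS.
    over.
  by [].
have qS : qf DK (polyfun K 2) (fun e => S (tnth e ord_max) (tnth e ord0)).
  apply: qf_and; first by apply: qf_neq0; apply: fr_proj.
  pose hd (e : (m + 2).+1.-tuple K) : m.+1.-tuple K :=
    [tuple of thead e :: [tuple tnth e (lift ord0 (lshift 2 l)) | l < m]].
  have Ph l : polyfun K (m + 2).+1 (fun e => tnth (hd e) l).
    case: (unliftP ord0 l) => [l' ->|->].
      by apply: fr_ext (fr_proj K (lift ord0 (lshift 2 l'))) => e; rewrite tnthS tnth_mktuple.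
    by apply: fr_ext (fr_proj K ord0) => e; rewrite tnth0.
  have pd := fr_proj K (lift ord0 (rshift m (ord_max : 'I_2))).
  have pt := fr_proj K (lift ord0 (rshift m (ord0 : 'I_2))).
  have q1 := qf_imp (qf_comp (fun f => polyfun_comp (f := f) Ph) qR)
    (qf_dv DK pd (fr_sub pt (fr_proj K ord0))).
  have := qf_ex_cat (qf_all_cons ntK q1); apply: qf_iff => e.
  have hde (k : m.-tuple K) x : hd [tuple of x :: [tuple of k ++ e]] = [tuple of x :: k].
    apply: eq_from_tnth => l; case: (unliftP ord0 l) => [l' ->|->].
      by rewrite !tnthS tnth_mktuple tnthS tnth_lshift.
    by rewrite !tnth0.
  split=> -[k h]; exists k => t'.
    move=> ht'; have := h t'; rewrite hde !tnthS !tnth_rshift tnth0; apply.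
    by rewrite theadE; move: ht'; congr (is_true (R _ _ _)); apply: val_inj.
  rewrite hde !tnthS !tnth_rshift tnth0 theadE => ht'; apply: h.
  by move: ht'; congr (is_true (R _ _ _)); apply: val_inj.
have qS' : qf DK (ext (polyfun K 1)) (fun e => S (tnth e.1 ord0) e.2).
  have := qf_comp (@polyfun_cons K 1) qS; apply: qf_iff => e.
  have -> : ord_max = lift ord0 ord0 :> 'I_2 by apply: val_inj.
  by rewrite tnthS tnth0; split.
have ball d t t' : S d t -> (S d t' <-> DK d (t - t')).
  move=> [d0 [k hk]]; split=> [[_ [k' hk']]|h]; last first.
    split=> //; exists k => t'' /hk h'; have -> : t' - t'' = (t - t'') - (t - t') by ring.
    exact: dv_sub.
  have [p hp hp'] : exists2 p, R i p k & R i p k'.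
    case/orP: (dv_total DL (X k) (X k')) => le.
      by exists (tnth k' i); [apply: center | apply: Rcenter].
    by exists (tnth k i); [apply: Rcenter | apply: center].
  have -> : t - t' = (t - p) - (t' - p) by ring.
  by apply: dv_sub; [apply: hk | apply: hk'].
apply: (@no_empty_chain K DK _ qS') => [d t t'|d d' t le|t] /=; rewrite ?tnth0.
- exact: ball.
- move=> [d0 [k hk]]; split; first exact: dv_neq0 le d0.
  by exists k => t' /hk; apply: dv_trans.
(* [k] excludes [t] and [k'] excludes k_i: the ball of radius v(k_i - k'_i) about k'_i contains the
   one given by [k'], but not [t]. *)
have [k nk] := hi t; have [k' nk'] := hi (tnth k i).
have le : DL (X k) (X k').
  case/orP: (dv_total DL (X k) (X k')) => // le.
  by rewrite (center i k' k le) in nk'.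
pose d := tnth k i - tnth k' i.
have d0 : d != 0.
  apply/eqP => e; case/negP: nk'; rewrite /R -/d e rmorph0 mul0r; exact: dvx0.
have ball_d : S d (tnth k' i).
  split=> //; exists k' => t' ht'.
  have : DL (iota d * tnth y i) (iota (t' - tnth k' i) * tnth y i).
    by apply: sdvW; apply: sdv_dv_trans ht'.
  by rewrite dv_mul2r // (dv_iota vext) dvBC.
exists d, (tnth k' i); rewrite ?tnth0; split=> // /(ball _ _ _ ball_d).
have s1 : sdv DK (t - tnth k i) d.
  rewrite /sdv -(dv_iota vext) -(dv_mul2r DL _ _ (y0 i)) -/(sdv DL _ _).
  apply: sdv_dv_trans nk _; have := center i k k' le; rewrite /R /d.
  by rewrite -(opprB (tnth k' i)) rmorphN mulNr dvNr.
have /andP[e1 _] := eqdv_add s1.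
have ee : t - tnth k i + d = t - tnth k' i by rewrite /d; ring.
rewrite ee in e1; rewrite dvBC => h.
by move: s1; rewrite /sdv (dv_trans h e1).
Qed.

Lemma vle_anti (a b : option GL) : vle a b -> vle b a -> a = b.
Proof.
by case: a => [a|]; case: b => [b|] //= ab ba; congr Some; apply/le_anti; rewrite ab.
Qed.

(** As b = (a + b) - a, both v(a) and v(b) are at least v(a + b). *)
Lemma val_addE (a b : L) : DL (a + b) a -> vL (a + b) = vmin (vL a) (vL b).
Proof.
move=> h; apply: vle_anti; last exact: val_add.
rewrite vle_vmin; apply/andP; split=> //.
have e : b = (a + b) - a by rewrite addrC addKr.
by rewrite [X in vle _ (vL X)]e; apply: (dv_sub (D := DL)) => //; apply: (dvxx DL).
Qed.

Lemma separated_lin_indep m (y : m.-tuple L) : (forall i, tnth y i != 0) ->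
  separated_seq iota vL y -> lin_indep iota y.
Proof.
move=> y0 hy k e i; have := dv_lincomb k 0 hy; rewrite e dvxx => -[/(_ isT) /(_ i) h _].
move/dv0x/eqP: h; rewrite mulf_eq0 (negPf (y0 i)) orbF fmorph_eq0.
by move/eqP.
Qed.

Lemma lincomb_cons m k0 (k : m.-tuple K) x0 (x : m.-tuple L) :
  lincomb iota [tuple of k0 :: k] [tuple of x0 :: x] = iota k0 * x0 + lincomb iota k x.
Proof.
rewrite /lincomb big_ord_recl !tnth0; congr (_ + _).
by apply: eq_bigr => i _; rewrite !tnthS.
Qed.

Lemma in_span_cons m x0 (x : m.-tuple L) z :
  in_span iota [tuple of x0 :: x] z <->
  exists k0, exists2 s, in_span iota x s & z = iota k0 * x0 + s.
Proof.
split=> [[k ->]|[k0 [_ [k ->] ->]]].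
  exists (thead k), (lincomb iota [tuple of behead k] x).
    by exists [tuple of behead k].
  by rewrite -lincomb_cons; congr lincomb; rewrite [LHS]tuple_eta; apply: val_inj.
by exists [tuple of k0 :: k]; rewrite lincomb_cons.
Qed.

Lemma in_span_lin m (x : m.-tuple L) c s s' : in_span iota x s -> in_span iota x s' ->
  in_span iota x (iota c * s + s').
Proof.
move=> [k ->] [k' ->]; exists [tuple c * tnth k i + tnth k' i | i < m].
rewrite /lincomb mulr_sumr -big_split; apply: eq_bigr => i _ /=.
by rewrite tnth_mktuple rmorphD rmorphM mulrDl mulrA.
Qed.

(** As in Gram-Schmidt orthogonalisation, a separated sequence is enlarged by [x0 - s0], where [s0]
    is a vector of its span closest to [x0]. *)
Lemma separated_extension_of_T : separated_extension iota vL.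
Proof.
(* Nonzero entries are easier to carry through the induction than linear independence, which follows
   from them and separatedness. *)
suff H : forall n (x : n.-tuple L), exists m (y : m.-tuple L),
    [/\ forall z, in_span iota x z <-> in_span iota y z,
      forall i, tnth y i != 0 & separated_seq iota vL y].
  move=> n x; have [m [y [sp y0 hy]]] := H n x; exists m, y; split=> //; split=> //.
  exact: separated_lin_indep.
elim=> [|n IH] x.
  exists 0%N, [tuple]; split=> [z|[]//|k]; first by rewrite (tuple0 x).
  by rewrite /lincomb !big_ord0 val0.
have [m [y [sp y0 hy]]] := IH [tuple of behead x].
have ex : x = [tuple of thead x :: [tuple of behead x]].
  by rewrite [LHS]tuple_eta; apply: val_inj.
have [k hk] := closest_vector (thead x) hy y0.
set x' := [tuple of behead x] in sp ex; set x0 := thead x in hk ex.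
pose s0 := lincomb iota k y; have s0P : in_span iota y s0 by exists k.
have [z0|z0] := eqVneq (x0 - s0) 0.
  exists m, y; split=> // z; rewrite ex in_span_cons.
  have -> : x0 = s0 by apply/eqP; rewrite -subr_eq0 z0.
  split=> [[k0 [s /sp hs ->]]|hz]; first exact: in_span_lin.
  by exists 0, z; [apply/sp | rewrite rmorph0 mul0r add0r].
exists m.+1, [tuple of (x0 - s0) :: y]; split=> [z|i|c].
- rewrite {1}ex !in_span_cons; split=> -[k0 [s hs ->]].
    exists k0, (iota k0 * s0 + s); first by apply: in_span_lin; rewrite // -sp.
    by ring.
  exists k0, (iota (- k0) * s0 + s); first by apply/sp; apply: in_span_lin.
  by rewrite rmorphN; ring.
- by case: (unliftP ord0 i) => [i' ->|->]; rewrite ?tnthS ?tnth0.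
have ec : c = [tuple of thead c :: [tuple of behead c]].
  by rewrite [LHS]tuple_eta; apply: val_inj.
rewrite {1}ec lincomb_cons big_ord_recl !tnth0.
have -> : \big[@vmin GL/None]_(i < m) vL (iota (tnth c (lift ord0 i)) *
    tnth [tuple of x0 - s0 :: y] (lift ord0 i)) = vL (lincomb iota [tuple of behead c] y).
  rewrite hy; apply: eq_bigr => i _; rewrite tnthS tnth_behead.
  by congr (vL (iota (tnth c _) * _)); apply: val_inj; rewrite /= inordK // ltnS.
set c0 := thead c; set c' := [tuple of behead c].
have [e|c00] := eqVneq c0 0.
  rewrite e -[tnth c ord0]/c0 e rmorph0 mul0r add0r val0 /vmin /=.
  by case: (vL _).
rewrite -[tnth c ord0]/c0; apply: val_addE.
(* Division by [c0] leaves [x0] minus a vector of the span of [y]; its value is at most v(x0 - s0),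
   which is the hypothesis of [val_addE]. *)
pose kk := [tuple tnth k i - tnth c' i / c0 | i < m].
have -> : iota c0 * (x0 - s0) + lincomb iota c' y = iota c0 * (x0 - lincomb iota kk y).
  have -> : lincomb iota kk y = s0 - (iota c0)^-1 * lincomb iota c' y.
    rewrite /lincomb mulr_sumr -sumrB; apply: eq_bigr => i _.
    by rewrite tnth_mktuple rmorphB fmorph_div; ring.
  by rewrite [- (s0 - _)]opprD opprK addrA [RHS]mulrDr mulVKf ?fmorph_eq0.
by rewrite dv_mul2l ?fmorph_eq0.
Qed.

End SeparatedBasis.

Theorem theorem1p9 (K L : closedFieldType) (GK GL : orderedGroupType)
    (vK : valuation K GK) (vL : valuation L GL)
    (iota : {rmorphism K -> L}) (j : {additive GK -> GL})
    (ntK : nontrivial vK) (ntL : nontrivial vL)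
    (ext : valued_extension vK vL iota j)
    (elem : @elementary vf_language (vf_structure vK) (vf_structure vL) iota) :
  (forall n : nat, (1 <= n)%N ->
     @T vf_language n (vf_structure vK) (vf_structure vL) iota)
  <->
  (separated_extension iota vL
   /\ @T og_language 1 (og_structure GK) (og_structure GL) j).
Proof.
split=> [hT|[sep hT1] n _]; last exact: T_of_separated ntK ntL ext sep hT1 n.
split; first exact: separated_extension_of_T ntK ext hT.
exact: T1_of_T ntK ntL ext hT.
Qed.
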